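(* Let $\sigma\subset\mathbb{C}$ be nonempty and compact, let $X$ be a complex Banach space and let $T\in B(X)$ be an $AC(\sigma)$ operator. Then (1) $\sigma(T)\subseteq\sigma$; and (2) $T$ is decomposable.
   Context: Let $\sigma\subset\mathbb{C}\cong\mathbb{R}^2$ be nonempty and compact. Let $\Gamma=C([0,1],\mathbb{C})$ be the set of curves. For $\gamma\in\Gamma$ and $f:\sigma\to\mathbb{C}$ put $\operatorname{cvar}(f,\gamma)=\sup\sum_{i=1}^{n-1}|f(s_{i+1})-f(s_i)|$, the supremum over finite sequences $s_i=\gamma(t_i)\in\sigma$ with $0\le t_1\le\dots\le t_n\le 1$. For a line $l$, $\operatorname{vf}(\gamma,l)$ is the number of times $\gamma$ crosses $l$, i.e. the number of entry points: $t\in[0,1]$ with $\gamma(t)\in l$ and either $t=0$ or for every $\epsilon>0$ there is $s\in(t-\epsilon,t)\cap[0,1]$ with $\gamma(s)\notin l$. Put $\operatorname{vf}(\gamma)=\sup_l\operatorname{vf}(\gamma,l)$, $\rho(\gamma)=1/\operatorname{vf}(\gamma)$ (with $\rho(\gamma)=0$ if $\operatorname{vf}(\gamma)=\infty$), $\operatorname{var}(f,\sigma)=\sup_{\gamma\in\Gamma}\rho(\gamma)\operatorname{cvar}(f,\gamma)$, and $\|f\|_{BV(\sigma)}=\|f\|_\infty+\operatorname{var}(f,\sigma)$. $BV(\sigma)$ is the Banach algebra of all $f:\sigma\to\mathbb{C}$ with $\|f\|_{BV(\sigma)}<\infty$, and $AC(\sigma)$ is the closed subalgebra of $BV(\sigma)$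 generated by $1$, $\boldsymbol{\lambda}$ and $\overline{\boldsymbol{\lambda}}$, where $\boldsymbol{\lambda}(z)=z$, with the $BV(\sigma)$ norm. $T\in B(X)$ is an $AC(\sigma)$ operator if there is a bounded unital algebra homomorphism $\psi:AC(\sigma)\to B(X)$ with $\psi(\boldsymbol{\lambda})=T$. $\sigma(T)$ denotes the spectrum of $T$. Decomposable (in the sense of Colojoară and Foiaş): a closed $T$-invariant subspace $Y\subseteq X$ is spectral maximal for $T$ if every closed $T$-invariant subspace $Z$ with $\sigma(T|Z)\subseteq\sigma(T|Y)$ satisfies $Z\subseteq Y$. $T$ is decomposable if for every finite open cover $\{G_i\}_{i=1}^n$ of $\sigma(T)$ there are spectral maximal subspaces $Y_1,\dots,Y_n$ of $T$ with $\sigma(T|Y_i)\subseteq G_i$ for all $i$ and $X=Y_1+\dots+Y_n$. *)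

(* Defs.v *)
From HB Require Import structures.
From mathcomp Require Import all_boot all_order all_algebra.
From mathcomp Require Import all_classical all_reals all_analysis.
From mathcomp Require Import complex.
Set Implicit Arguments.
Unset Strict Implicit.
Unset Printing Implicit Defensive.
Import Order.TTheory GRing.Theory Num.Theory.
Import numFieldNormedType.Exports.

Local Open Scope classical_set_scope.
Local Open Scope ring_scope.

(* R[i] over itself, with the topology of its R[i]-valued modulus: MathComp-Analysis
   has this for an abstract numClosedFieldType but not for the concrete R[i]. *)
#[export, non_forgetful_inheritance]
HB.instance Definition _ (R : rcfType) := PseudoPointedMetric.copy R[i] R[i]^o.
#[export, non_forgetful_inheritance]
HB.instance Definition _ (R : rcfType) := GRing.ComAlgebra.copy R[i] R[i]^o.
#[export, non_forgetful_inheritance]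
HB.instance Definition _ (R : rcfType) := Vector.copy R[i] R[i]^o.
#[export, non_forgetful_inheritance]
HB.instance Definition _ (R : rcfType) := NormedModule.copy R[i] R[i]^o.

Section BV.
Variable R : realType.
Local Notation C := R[i].
Implicit Types (s : set C) (l : set C) (gamma : R -> C).

(* The modulus as an element of R; `|z| itself lives in R[i]. *)
Definition cabs (z : C) : R := complex.Re `|z|.

(* C([0,1], C); the values of gamma outside [0,1] are never used. *)
Definition curve gamma : Prop := {within `[0%R, 1%R], continuous gamma}.

Definition line l : Prop :=
  exists p d : C, d != 0 /\ l = [set p + (t%:C)%C * d | t in [set: R]].

Definition entry_point gamma l (t : R) : Prop :=
  [/\ t \in `[0, 1], l (gamma t)
    & t = 0 \/ forall e : R, 0 < e ->
        exists u : R, [/\ u \in `]t - e, t[, u \in `[0, 1] & ~ l (gamma u)]].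

Definition vf_line gamma l : \bar R := counting [set t | entry_point gamma l t].

Definition vf gamma : \bar R := ereal_sup [set vf_line gamma l | l in line].

Definition rho gamma : R :=
  if vf gamma == +oo%E then 0 else (fine (vf gamma))^-1.

(* t and z are the sequences t_i and s_i, indexed from 0 and relevant below n.
   n = 0 is allowed, so that cvar is 0 on a curve that misses s. *)
Definition cvar s (f : s -> C) gamma : \bar R :=
  ereal_sup [set v : \bar R | exists (n : nat) (t : nat -> R) (z : nat -> s),
    [/\ forall i, (i < n)%N -> t i \in `[0, 1],
        forall i, (i.+1 < n)%N -> t i <= t i.+1,
        forall i, (i < n)%N -> gamma (t i) = \val (z i)
      & v = (\sum_(0 <= i < n.-1) cabs (f (z i.+1) - f (z i)))%:E]].

(* Since 0 * +oo = 0 in \bar R, curves with rho gamma = 0 contribute 0. *)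
Definition var s (f : s -> C) : \bar R :=
  ereal_sup [set ((rho gamma)%:E * cvar f gamma)%E | gamma in curve].

Definition supnorm s (f : s -> C) : \bar R :=
  ereal_sup [set (cabs (f z))%:E | z in [set: s]].

Definition BVnorm s (f : s -> C) : \bar R := (supnorm f + var f)%E.

Definition BV s : set (s -> C) := [set f | (BVnorm f < +oo)%E].

Definition BV_closed s (A : set (s -> C)) : Prop :=
  forall f : s -> C, BV f -> (forall e : R, 0 < e ->
    exists2 g : s -> C, A g & (BVnorm (f - g)%R < e%:E)%E) -> A f.

Definition closed_subalgebra s (A : set (s -> C)) : Prop :=
  [/\ A `<=` BV (s := s),
      A 0,
      forall (a : C) f g, A f -> A g -> A (a *: f + g),
      forall f g, A f -> A g -> A (f * g)
    & BV_closed A].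

Definition lambda s : s -> C := fun z => \val z.
Definition lambda_bar s : s -> C := fun z => (\val z)^*.

Definition ACfun s : set (s -> C) :=
  smallest (@closed_subalgebra s) [set 1; @lambda s; @lambda_bar s].

End BV.

Section Operators.
Variables (R : realType) (X : completeNormedModType R[i]).
Local Notation C := R[i].
Implicit Types (T : X -> X) (Y Z : set X).

(* psi is total, but constrained only on ACfun; there each psi f lies in B(X). *)
Definition AC_operator (s : set C) T : Prop :=
  exists psi : (s -> C) -> {linear X -> X},
    [/\ [/\ forall f, ACfun f -> continuous (psi f),
            forall (a : C) f g, ACfun f -> ACfun g ->
              forall x, psi (a *: f + g) x = a *: psi f x + psi g x
          & forall f g, ACfun f -> ACfun g -> forall x, psi (f * g) x = psi f (psi g x)],
        forall x, psi 1 x = x,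
        exists K : R, forall f, ACfun f -> forall x : X,
          `|psi f x| <= ((K * fine (BVnorm f))%:C)%C * `|x|
      & forall x, psi (@lambda R s) x = T x].

Definition closed_subspace Y : Prop :=
  [/\ closed Y, Y 0 & forall (a : C) x y, Y x -> Y y -> Y (a *: x + y)].

Definition closed_invariant T Y : Prop :=
  closed_subspace Y /\ forall y, Y y -> Y (T y).

(* sigma(T|Y): the mu for which T|Y - mu has no inverse in B(Y). *)
Definition spectrum_on Y T : set C :=
  [set mu | ~ exists S : X -> X,
    [/\ forall y, Y y -> Y (S y),
        forall (a : C) x y, Y x -> Y y -> S (a *: x + y) = a *: S x + S y,
        {within Y, continuous S},
        forall y, Y y -> S (T y - mu *: y) = y
      & forall y, Y y -> T (S y) - mu *: S y = y]].

Definition spectrum T : set C := spectrum_on [set: X] T.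

Definition spectral_maximal T Y : Prop :=
  closed_invariant T Y /\
  forall Z, closed_invariant T Z ->
    spectrum_on Z T `<=` spectrum_on Y T -> Z `<=` Y.

Definition decomposable T : Prop :=
  forall (n : nat) (G : 'I_n -> set C),
    (forall i, open (G i)) -> spectrum T `<=` \bigcup_i G i ->
    exists Y : 'I_n -> set X,
      [/\ forall i, spectral_maximal T (Y i),
          forall i, spectrum_on (Y i) T `<=` G i
        & forall x, exists2 y : 'I_n -> X,
            (forall i, Y i (y i)) & x = \sum_(i < n) y i].

End Operators.

(* Main.v *)
Require Import Defs.
From mathcomp Require Import all_boot all_order all_algebra.
From mathcomp Require Import finmap.
From mathcomp Require Import all_classical all_reals all_analysis.
From mathcomp Require Import complex.
From mathcomp Require Import ring lra.
Set Implicit Arguments.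
Unset Strict Implicit.
Unset Printing Implicit Defensive.
Import Order.TTheory GRing.Theory Num.Theory.
Import numFieldNormedType.Exports.
Local Open Scope classical_set_scope.
Local Open Scope ring_scope.

(** A bounded homomorphism psi on AC makes T decomposable because AC contains
    enough functions: inverses of its functions with a positive lower bound, and
    cut-off functions.
    Granting these, the argument is that of Colojoara and Foias for generalised
    scalar operators.

    To a set F is attached the space of the vectors x with psi f x = 0 for all f
    in AC vanishing near F [spectral_space]. For closed F it is closed and
    invariant, and division by z - mu away from mu inverts T - mu on it, so its
    spectrum lies in F [spectrum_spectral_space]; for F = sigma this is the
    inclusion of the spectrum of T in sigma. It is spectral maximal
    [spectral_space_maximal], the point being that if T - mu is invertible on an
    invariant subspace Z, then functions carried by a small square around mu
    annihilate Z [psi_local_null]. The usual proof of this applies Liouville's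
    theorem to a vector-valued entire function; here a norm estimate suffices,
    because z - mu can be cut off to a function of AC whose BV norm is
    proportional to the size of the square. A partition of unity
    [AC_localisation] then decomposes X.

    The cut-off functions come from the following facts. A monotone function of
    Re z has variation at most its range, since the curve must cross the line
    Re z = c each time it passes c [sum_along_monotone]. AC contains the inverses
    of its functions bounded below by a positive constant, as sums of geometric
    series [AC_inv]. Hence it contains the Heron iterates for the square root of
    (Re z - a)^2; their error is a decreasing function of |Re z - a|, so it
    tends to 0 in variation, and |Re z - a| is in AC [AC_abs]. Linear
    combinations give the piecewise linear functions of Re z, likewise of Im z,
    and products give the plateaus on squares. *)

(** * Sums of increments of a monotone function *)

Section Telescoping.
Variable R : realType.

(** The multiplicity bound behind the variation estimate: the intervals
    [a i, b i] cut the line into elementary pieces between consecutive end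
    points, every piece is covered at most N times, and the increments of phi
    over the pieces add up to at most be - al. *)
Lemma sum_increments_le (I : finType) (a b : I -> R) (phi : R -> R)
    (al be N : R) :
  (forall i, a i <= b i) -> 0 <= N ->
  {homo phi : x y / x <= y} -> (forall x, al <= phi x <= be) ->
  (forall c, (forall i, c != a i /\ c != b i) ->
     (#|[pred i | a i < c < b i]|%:R <= N)) ->
  \sum_i (phi (b i) - phi (a i)) <= N * (be - al).
Proof.
move=> ab N0 phih phib cov.
pose y := sort <=%R (map a (enum I) ++ map b (enum I)).
have ys : sorted <=%R y by apply: sort_sorted; exact: le_total.
have ay i : a i \in y by rewrite mem_sort mem_cat map_f ?mem_enum.
have byi i : b i \in y by rewrite mem_sort mem_cat [X in _ || X]map_f ?mem_enum ?orbT.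
pose m := size y.
have yle (j k : nat) : (j <= k)%N -> (k < m)%N -> nth 0 y j <= nth 0 y k.
  move=> jk km; apply: (sorted_leq_nth le_trans le_refl) => //.
  by rewrite inE (leq_ltn_trans jk).
pose D j := phi (nth 0 y j.+1) - phi (nth 0 y j).
have D0 j : (j < m.-1)%N -> 0 <= D j.
  move=> jm; rewrite /D subr_ge0; apply: phih; apply: yle => //.
  by move: jm; case: (m).
pose Q i j := (a i <= nth 0 y j) && (nth 0 y j.+1 <= b i).
have split_i i : phi (b i) - phi (a i) <= \sum_(0 <= j < m.-1) (Q i j)%:R * D j.
  have pm : (index (a i) y < m)%N by rewrite index_mem.
  have qm : (index (b i) y < m)%N by rewrite index_mem.
  set p := index (a i) y in pm *; set q := index (b i) y in qm *.
  have Ep : nth 0 y p = a i by exact: nth_index.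
  have Eq : nth 0 y q = b i by exact: nth_index.
  have Qge j : (j < m.-1)%N -> 0 <= (Q i j)%:R * D j.
    by move=> jm; rewrite mulr_ge0// ?ler0n// D0.
  have [pq|qp] := leqP p q; last first.
    have -> : a i = b i.
      by apply: le_anti; rewrite ab/= -Ep -Eq yle// ltnW.
    rewrite subrr big_seq_cond; apply: sumr_ge0 => j.
    by rewrite andbT mem_index_iota => /andP[_ /Qge].
  have qm1 : (q <= m.-1)%N by move: qm; case: (m).
  rewrite (big_cat_nat (n := p)) ?(leq_trans pq)//=.
  rewrite (big_cat_nat (m := p) (n := q))//=.
  have -> : phi (b i) - phi (a i) = \sum_(p <= j < q) (Q i j)%:R * D j.
    rewrite -Eq -Ep -(telescope_sumr (fun j => phi (nth 0 y j)) pq).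
    apply: eq_big_nat => j /andP[pj jq].
    by rewrite /Q -Ep -Eq !yle// ?mul1r// (leq_ltn_trans _ qm)// ltnW.
  rewrite addrCA lerDl addr_ge0//; rewrite big_seq_cond; apply: sumr_ge0 => j;
    rewrite andbT mem_index_iota => /andP[j1 j2]; apply: Qge => //.
  by apply: (leq_trans j2); apply: leq_trans pq _.
apply: (le_trans (ler_sum _ (fun i _ => split_i i))).
rewrite exchange_big/=.
have main j : (j < m.-1)%N -> \sum_i (Q i j)%:R * D j <= N * D j.
  move=> jm; rewrite -mulr_suml.
  have j1m : (j.+1 < m)%N by move: jm; case: (m).
  have := yle j j.+1 (leqnSn _) j1m; rewrite le_eqVlt => /orP[/eqP e|lt].
    by rewrite /D e subrr !mulr0.
  apply: ler_wpM2r; first exact: D0.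
  (* The midpoint of a nondegenerate piece is no end point, so the covering
     hypothesis applies to it. *)
  set c := (nth 0 y j + nth 0 y j.+1) / 2.
  have c1 : nth 0 y j < c by rewrite /c; lra.
  have c2 : c < nth 0 y j.+1 by rewrite /c; lra.
  have cn x : x \in y -> c != x.
    move=> xy; apply/eqP => cx.
    have xm : (index x y < m)%N by rewrite index_mem.
    have Ex : nth 0 y (index x y) = x by exact: nth_index.
    have [k|k] := leqP (index x y) j.
      by have := yle _ _ k (ltnW j1m); rewrite Ex -cx leNgt c1.
    by have := yle _ _ k xm; rewrite Ex -cx leNgt c2.
  have := cov c (fun i => conj (cn _ (ay i)) (cn _ (byi i))).
  apply: le_trans; rewrite -natr_sum ler_nat -sum1_card [X in (_ <= X)%N]big_mkcond/=.
  apply: leq_sum => i _; rewrite inE /Q.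
  case: (boolP (a i <= _)) => //= h1; case: (boolP (_ <= b i)) => //= h2.
  by rewrite (le_lt_trans h1 c1) (lt_le_trans c2 h2).
apply: (@le_trans _ _ (\sum_(0 <= j < m.-1) N * D j)).
  rewrite !big_mkord; apply: ler_sum => j _; exact: main.
rewrite -mulr_sumr ler_wpM2l// (telescope_sumr (fun j => phi (nth 0 y j)))//.
by have /andP[_ h1] := phib (nth 0 y m.-1); have /andP[h2 _] := phib (nth 0 y 0%N); lra.
Qed.

End Telescoping.

(** * Crossings of lines by curves *)

Section FirstPassage.
Variable R : realType.

(** The infimum of the times at which g is at least c. Stating it for the first
    passage, and not for an arbitrary solution of g tau = c, is what turns it
    into an entry point. *)
Lemma first_passage (g : R -> R) (a b c : R) :
  {within `[a, b], continuous g} -> a <= b -> g a < c -> c <= g b ->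
  exists tau, [/\ a < tau, tau <= b, g tau = c & forall u, a <= u < tau -> g u < c].
Proof.
move=> /subspace_continuousP gc ab ga gb.
have gd t : a <= t <= b -> forall e, 0 < e -> exists2 d, 0 < d &
    forall u, a <= u <= b -> `|t - u| < d -> `|g t - g u| < e.
  move=> tab e e0; have tA : `[a, b]%classic t by rewrite /= in_itv.
  have /cvgrPdist_lt/(_ e e0)/nbhs_ballP[d /= d0 dP] := gc t tA.
  by exists d => // u uab du; apply: dP; rewrite ?/ball//= in_itv.
pose E := [set t | a <= t <= b /\ c <= g t].
have Eb : E b by split => //; rewrite ab lexx.
have Elb : has_lbound E by exists a => x [] /andP[].
have Einf : has_inf E by split => //; exists b.
pose tau := inf E.
have atau : a <= tau by apply: lb_le_inf; [exists b|move=> x [] /andP[]].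
have taub : tau <= b by apply: ge_inf.
have below u : a <= u < tau -> g u < c.
  move=> /andP[au ut]; rewrite ltNge; apply/negP => cu.
  have : tau <= u by apply: ge_inf => //; split=> //; rewrite au (le_trans (ltW ut)).
  by rewrite leNgt ut.
have tab : a <= tau <= b by rewrite atau.
have ctau : c <= g tau.
  rewrite leNgt; apply/negP => gt.
  have [|d d0 dP] := gd tau tab (c - g tau); first by rewrite subr_gt0.
  have [x [xab cx] xd] := inf_adherent d0 Einf.
  have tx : tau <= x by apply: ge_inf.
  have : `|g tau - g x| < c - g tau.
    by apply: dP => //; rewrite distrC ger0_norm ?subr_ge0// ltrBlDl.
  by rewrite distrC; move/(le_lt_trans (ler_norm _)); rewrite ltrD2r ltNge cx.
have altau : a < tau.
  by rewrite lt_neqAle atau andbT; apply: contraTneq ga => ->; rewrite -leNgt.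
exists tau; split => //; apply: le_anti; rewrite ctau andbT leNgt; apply/negP => gt.
have [|d d0 dP] := gd tau tab (g tau - c); first by rewrite subr_gt0.
pose u := Num.max a (tau - d / 2).
have ut : u < tau by rewrite gt_max altau/=; lra.
have au : a <= u by rewrite le_max lexx.
have ud : tau - d / 2 <= u by rewrite le_max lexx orbT.
have uab : a <= u <= b by rewrite au (le_trans (ltW ut)).
have := dP u uab; rewrite ger0_norm ?subr_ge0 ?ltW// => /(_ ltac:(lra)).
have := below u; rewrite au ut => /(_ isT) guc.
by move/(le_lt_trans (ler_norm _)); lra.
Qed.

End FirstPassage.

Section Crossings.
Variable R : realType.
Local Notation C := R[i].

Lemma Re_continuous : continuous (@complex.Re R : C -> R).
Proof.
move=> z; apply/(@cvgrPdist_lt _ _ _ _ (nbhs_filter z)) => e e0.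
have : \forall w \near z, `|z - w| < e%:C%C.
  by apply: (@nbhsx_ballx _ _ z (e%:C)%C); rewrite ltcR.
apply: (@filterS _ _ (nbhs_filter z)) => w; rewrite -ltcR; apply: le_lt_trans.
by rewrite -raddfB; exact: normc_ge_Re.
Qed.

Lemma Im_continuous : continuous (@complex.Im R : C -> R).
Proof.
move=> z; apply/(@cvgrPdist_lt _ _ _ _ (nbhs_filter z)) => e e0.
have : \forall w \near z, `|z - w| < e%:C%C.
  by apply: (@nbhsx_ballx _ _ z (e%:C)%C); rewrite ltcR.
apply: (@filterS _ _ (nbhs_filter z)) => w; rewrite -ltcR; apply: le_lt_trans.
have -> : complex.Im z - complex.Im w = complex.Re (- 'i%C * (z - w)).
  by case: z w => [a b] [c d] /=; ring.
apply: le_trans (normc_ge_Re _) _.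
by rewrite normrM normrN complexiE normCi mul1r.
Qed.

(** As the level sets are lines, crossing numbers control the variation of such a
    functional along a curve; the real and imaginary parts are the examples. *)
Definition coordinate (l : C -> R) :=
  continuous l /\ forall c, line [set z | l z = c].

Lemma Re_coordinate : coordinate (@complex.Re R).
Proof.
split=> [|c]; first exact: Re_continuous.
exists (c%:C)%C, 'i%C; split.
  by rewrite eq_complex /= oner_eq0 andbF.
apply/seteqP; split=> [[x y] /= <-|_ [t _ <-]]; last by simpl; ring.
by exists y => //; apply/eqP; rewrite eq_complex /=; apply/andP; split; apply/eqP; ring.
Qed.

Lemma Im_coordinate : coordinate (@complex.Im R).
Proof.
split=> [|c]; first exact: Im_continuous.
exists (c *i)%C, 1; split; first exact: oner_neq0.
apply/seteqP; split=> [[x y] /= <-|_ [t _ <-]]; last by simpl; ring.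
by exists x => //; apply/eqP; rewrite eq_complex /=; apply/andP; split; apply/eqP; ring.
Qed.

Lemma entry_between (l : C -> R) (gamma : R -> C) (t1 t2 c : R) :
  coordinate l -> curve gamma -> 0 <= t1 -> t1 <= t2 -> t2 <= 1 ->
  (l (gamma t1) < c < l (gamma t2)) || (l (gamma t2) < c < l (gamma t1)) ->
  exists2 tau, t1 < tau <= t2 & entry_point gamma [set z | l z = c] tau.
Proof.
move=> [lc _] gc t10 t12 t21 H.
have lgc0 : {within `[0, 1], continuous (l \o gamma)}.
  by move=> x; exact: (continuous_comp (gc x) (lc (gamma x))).
have lgc : {within `[t1, t2], continuous (l \o gamma)}.
  by apply: continuous_subspaceW lgc0; apply: subset_itv; rewrite bnd_simp.
have [tau [a1 a2 a3 a4]] : exists tau, [/\ t1 < tau, tau <= t2, l (gamma tau) = c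
    & forall u, t1 <= u < tau -> l (gamma u) <> c].
  case/orP: H => /andP[h1 h2].
    have [tau [? ? ? h]] := first_passage lgc t12 h1 (ltW h2).
    by exists tau; split=> // u /h /= /[swap] ->; rewrite ltxx.
  have lgc' : {within `[t1, t2], continuous (fun t => - l (gamma t))}.
    by move=> x; apply: cvgN; exact: lgc.
  have [||tau [? ? /oppr_inj ? h]] := first_passage (c := - c) lgc' t12.
  - by rewrite ltrN2.
  - by rewrite lerN2 ltW.
  by exists tau; split=> // u /h /= /[swap] ->; rewrite ltxx.
exists tau; first by rewrite a1.
split=> //; first by rewrite in_itv/= (le_trans t10 (ltW a1)) (le_trans a2).
right=> e e0; pose u := Num.max t1 (tau - e / 2).
have ut : u < tau by rewrite gt_max a1/=; lra.
have au : t1 <= u by rewrite le_max lexx.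
have ud : tau - e / 2 <= u by rewrite le_max lexx orbT.
exists u; split.
- by rewrite in_itv/= ut andbT; lra.
- by rewrite in_itv/= (le_trans t10 au)/= (le_trans (ltW ut))// (le_trans a2).
- by apply: a4; rewrite au.
Qed.

(** Only lower bounds on a number of entry points are ever used, and those are
    given by finitely many distinct ones. *)
Lemma le_counting (A : set R) (I : finType) (P : pred I) (h : I -> R) :
  {in P &, injective h} -> (forall i, P i -> A (h i)) ->
  ((#|P|%:R)%:E <= counting A :> \bar R)%E.
Proof.
move=> hi hA; rewrite /counting; case: asboolP => [fA|_]; last exact: leey.
rewrite lee_fin ler_nat.
have : uniq (map h (enum P)).
  by rewrite map_inj_in_uniq ?enum_uniq// => i j; rewrite !mem_enum; exact: hi.
have sub : {subset map h (enum P) <= fset_set A}.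
  move=> x /mapP[k]; rewrite mem_enum => Pk ->.
  by rewrite in_fset_set// inE; exact: hA.
by rewrite cardE -(size_map h) => /uniq_leq_size; exact.
Qed.

(** Time 0 is an entry point of any line through the starting point, so that rho
    never divides by 0. *)
Lemma vf_ge1 (gamma : R -> C) : (1%:E <= vf gamma)%E.
Proof.
have [_ /(_ (complex.Re (gamma 0))) L] := Re_coordinate.
apply: (@le_trans _ _ (vf_line gamma [set z | complex.Re z = complex.Re (gamma 0)])); last first.
  by apply: ereal_sup_ubound; exists [set z | complex.Re z = complex.Re (gamma 0)].
have := @le_counting [set t | entry_point gamma [set z | complex.Re z = complex.Re (gamma 0)] t]
  unit predT (fun=> 0).
rewrite card_unit; apply => [[] []//|_ _ /=].
by split => //; [rewrite in_itv/= lexx ler01|left].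
Qed.

(** For c outside the sampled values, each step of the sample that jumps over c
    contains an entry point of the line l = c, and distinct steps contain
    distinct ones. Hence every c is jumped over at most vf gamma times, and the
    multiplicity bound applies. *)
Lemma sum_along_monotone (l : C -> R) (gamma : R -> C) (v al be : R)
    (phi : R -> R) (n : nat) (t : nat -> R) :
  coordinate l -> curve gamma -> vf gamma = v%:E ->
  {homo phi : x y / x <= y} -> (forall x, al <= phi x <= be) ->
  (forall i, (i < n)%N -> t i \in `[0, 1]) ->
  (forall i, (i.+1 < n)%N -> t i <= t i.+1) ->
  \sum_(0 <= i < n.-1) `|phi (l (gamma (t i.+1))) - phi (l (gamma (t i)))|
    <= v * (be - al).
Proof.
move=> lP gc vE phih phib t01 tm.
pose x i := l (gamma (t i)).
have v1 : 1 <= v by rewrite -lee_fin -vE; exact: vf_ge1.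
have v0 : 0 <= v by lra.
rewrite big_mkord.
have sn (i : 'I_n.-1) : (i.+1 < n)%N by case: i => i /=; case: (n).
rewrite (eq_bigr (fun i : 'I_n.-1 =>
  phi (Num.max (x i) (x i.+1)) - phi (Num.min (x i) (x i.+1)))); last first.
  move=> i _; rewrite -/(x i) -/(x i.+1).
  have [h|h] := leP (x i) (x i.+1).
    by rewrite ger0_norm// subr_ge0 phih.
  by rewrite ler0_norm ?opprB// subr_le0 phih// ltW.
apply: sum_increments_le => //.
  by move=> i; rewrite ge_min !le_max lexx.
move=> c _; rewrite -lee_fin -vE.
have [_ /(_ c) L] := lP.
apply: (@le_trans _ _ (vf_line gamma [set z | l z = c])); last first.
  by apply: ereal_sup_ubound; exists [set z | l z = c].
set P := (X in #|X|).
have ent (i : 'I_n.-1) : exists tau, P i ->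
    t i < tau <= t i.+1 /\ entry_point gamma [set z | l z = c] tau.
  have [|nPi] := boolP (P i); last by exists 0.
  rewrite inE => Pi.
  have /[!in_itv]/= /andP[t0 _] := t01 i (ltnW (sn i)).
  have /[!in_itv]/= /andP[_ t1] := t01 i.+1 (sn i).
  have [||tau h1 h2] := @entry_between l gamma (t i) (t i.+1) c lP gc t0 _ t1.
  - exact: tm (sn i).
  - rewrite -/(x i) -/(x i.+1).
    by move: Pi; have [_|_] := leP (x i) (x i.+1) => ->; rewrite ?orbT.
  by exists tau.
have [h hP] := choice ent.
have tmono (j k : nat) : (j <= k)%N -> (k < n)%N -> t j <= t k.
  elim: k => [|k IH]; first by rewrite leqn0 => /eqP ->.
  rewrite leq_eqVlt => /orP[/eqP -> //|jk kn].
  by apply: le_trans (tm k kn); apply: IH => //; exact: ltnW.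
have sep (p q : 'I_n.-1) : P p -> P q -> (p < q)%N -> h p < h q.
  move=> Pp Pq pq.
  have [/andP[_ h1] _] := hP p Pp; have [/andP[h2 _] _] := hP q Pq.
  by apply: le_lt_trans h2; apply: le_trans h1 _; apply: tmono => //; exact: ltnW (sn q).
apply: (@le_counting _ _ P h) => [p q Pp Pq hpq|p Pp]; last by have [] := hP p Pp.
apply/val_inj; case: (ltngtP p q) => // pq.
  by have := sep p q Pp Pq pq; rewrite hpq ltxx.
by have := sep q p Pq Pp pq; rewrite hpq ltxx.
Qed.

End Crossings.

(** * Bounds on the variation *)

Section Modulus.
Variable R : realType.
Implicit Types z w : R[i].

Lemma cabsE z : ((cabs z)%:C)%C = `|z|.
Proof. by rewrite /cabs RRe_real// normr_real. Qed.

Lemma cabs_ge0 z : 0 <= cabs z.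
Proof. by rewrite -ler0c cabsE normr_ge0. Qed.

Lemma cabsD z w : cabs (z + w) <= cabs z + cabs w.
Proof. by rewrite -lecR rmorphD/= !cabsE ler_normD. Qed.

Lemma cabsM z w : cabs (z * w) = cabs z * cabs w.
Proof. by apply: complexI; rewrite rmorphM/= !cabsE normrM. Qed.

Lemma cabsR (x : R) : cabs (x%:C)%C = `|x|.
Proof. by rewrite /cabs normc_def /= expr0n/= addr0 sqrtr_sqr. Qed.

Lemma cabs_conj z : cabs (z^*)%C = cabs z.
Proof. by apply: complexI; rewrite !cabsE normcJ. Qed.

Lemma Re_le_cabs z : `|complex.Re z| <= cabs z.
Proof. by rewrite -lecR cabsE normc_ge_Re. Qed.

Lemma cabs_le_ReIm z : cabs z <= `|complex.Re z| + `|complex.Im z|.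
Proof.
rewrite {1}[z]complexE; apply: le_trans (cabsD _ _) _.
rewrite cabsM !cabsR lerD2l.
have -> : cabs ('i%C : R[i]) = 1.
  by apply: complexI; rewrite cabsE complexiE normCi.
by rewrite mul1r.
Qed.

End Modulus.

Section Bounds.
Variables (R : realType) (s : set R[i]).
Local Notation C := R[i].
Implicit Types (f g h : s -> C).

Definition along (gamma : R -> C) (n : nat) (t : nat -> R) (z : nat -> s) : Prop :=
  [/\ forall i, (i < n)%N -> t i \in `[0, 1],
      forall i, (i.+1 < n)%N -> t i <= t i.+1
    & forall i, (i < n)%N -> gamma (t i) = \val (z i)].

(** An upper bound for the two parts of the BV norm, in terms of real numbers
    only. Curves with infinite vf have weight 0 and are left out. *)
Definition bv_bound f (B V : R) : Prop :=
  [/\ forall z, cabs (f z) <= B, 0 <= V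
    & forall gamma v n t z, curve gamma -> vf gamma = v%:E ->
        along gamma n t z ->
        \sum_(0 <= i < n.-1) cabs (f (z i.+1) - f (z i)) <= v * V].

Lemma vf_real_ge0 (gamma : R -> C) v : vf gamma = v%:E -> 1 <= v.
Proof. by move=> vE; rewrite -lee_fin -vE vf_ge1. Qed.

Lemma BVnorm_le f B V : bv_bound f B V -> (BVnorm f <= (B + V)%:E)%E.
Proof.
move=> [fB V0 fV]; rewrite /BVnorm EFinD; apply: leeD.
  by apply: ge_ereal_sup => _ [z _ <-]; rewrite lee_fin.
apply: ge_ereal_sup => _ [gamma gc <-]; rewrite /rho.
case: ifPn => [_|vfoo]; first by rewrite mul0e lee_fin.
have [v vE] : exists v, vf gamma = v%:E.
  move: (vf_ge1 gamma) vfoo; case: (vf gamma) => [v| |] //= _ _; by exists v.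
have v1 := vf_real_ge0 vE; rewrite vE/=.
rewrite muleC -lee_pdivlMr ?invr_gt0; last lra.
apply: ge_ereal_sup => _ [n [t [z [h1 h2 h3 ->]]]].
rewrite invrK -EFinM lee_fin mulrC.
by have := fV gamma v n t z gc vE; apply.
Qed.

Lemma supnorm_ge0 f : s !=set0 -> (0 <= supnorm f)%E.
Proof.
move=> [z0 sz0]; apply: (@le_trans _ _ (cabs (f (SigSub (mem_set sz0))))%:E).
  by rewrite lee_fin cabs_ge0.
by apply: ereal_sup_ubound; exists (SigSub (mem_set sz0)).
Qed.

Lemma var_ge0 f : s !=set0 -> (0 <= var f)%E.
Proof.
move=> [z0 sz0].
have cvar0 gamma : (0 <= cvar f gamma)%E.
  apply: ereal_sup_ubound; exists 0%N, (fun=> 0), (fun=> SigSub (mem_set sz0)).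
  by split=> //; rewrite big_nil.
pose g : R -> C := fun=> 0.
have h1 : ((rho g)%:E * cvar f g <= var f)%E.
  by apply: ereal_sup_ubound; exists g => // x; exact: cst_continuous.
apply: le_trans h1; rewrite mule_ge0// lee_fin /rho.
case: ifP => // _; rewrite invr_ge0 fine_ge0//.
by apply: le_trans (vf_ge1 _); rewrite lee_fin.
Qed.

Lemma fine_BVnorm_ge0 f : s !=set0 -> 0 <= fine (BVnorm f).
Proof. by move=> s0; rewrite fine_ge0// adde_ge0 ?supnorm_ge0 ?var_ge0. Qed.

Lemma BV_bv_bound f : s !=set0 -> BV f -> exists B V, bv_bound f B V.
Proof.
move=> s0; rewrite /BV /= /BVnorm => fBV.
have sup0 := supnorm_ge0 f s0; have var0 := var_ge0 f s0.
have [B BE] : exists B, supnorm f = B%:E.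
  move: fBV sup0 var0; case: (supnorm f) (var f) => [B| |] [V| |] //=; by exists B.
have [V VE] : exists V, var f = V%:E.
  move: fBV sup0 var0; case: (supnorm f) (var f) => [?| |] [V| |] //=; by exists V.
exists B, V; split.
- by move=> z; rewrite -lee_fin -BE; apply: ereal_sup_ubound; exists z.
- by rewrite -lee_fin -VE.
move=> gamma v n t z gc vE [h1 h2 h3].
have v1 := vf_real_ge0 vE.
have : ((rho gamma)%:E * cvar f gamma <= V%:E)%E.
  by rewrite -VE; apply: ereal_sup_ubound; exists gamma.
rewrite /rho vE/= muleC -lee_pdivlMr ?invr_gt0; last lra.
rewrite invrK -EFinM mulrC; set S := (\sum_(_ <= _ < _) _) => cV.
rewrite -lee_fin; apply: le_trans cV; apply: ereal_sup_ubound.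
by exists n, t, z.
Qed.

Lemma fine_BVnorm_le f B V : s !=set0 -> bv_bound f B V -> fine (BVnorm f) <= B + V.
Proof.
move=> s0 /BVnorm_le; have : (0 <= BVnorm f)%E by rewrite adde_ge0 ?supnorm_ge0 ?var_ge0.
by case: (BVnorm f).
Qed.

Lemma bv_bound_BV f B V : bv_bound f B V -> BV f.
Proof. by move=> /BVnorm_le h; rewrite /BV/=; apply: le_lt_trans h _; rewrite ltry. Qed.

(** All stability properties of bounds (sums, products, Lipschitz maps) reduce
    to a comparison of single increments. *)
Lemma bv_bound_comb f g h B Bf Vf Bg Vg (a b : R) :
  bv_bound f Bf Vf -> bv_bound g Bg Vg -> 0 <= a -> 0 <= b ->
  (forall z, cabs (h z) <= B) ->
  (forall z w, cabs (h z - h w) <= a * cabs (f z - f w) + b * cabs (g z - g w)) ->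
  bv_bound h B (a * Vf + b * Vg).
Proof.
move=> [_ Vf0 fV] [_ Vg0 gV] a0 b0 hB hV; split=> //.
  by rewrite addr_ge0// mulr_ge0.
move=> gamma v n t z gc vE al.
apply: le_trans (ler_sum _ (fun i _ => hV (z i.+1) (z i))) _.
rewrite big_split/= -!mulr_sumr mulrDr !(mulrCA v) lerD//.
  by rewrite ler_wpM2l//; exact: fV al.
by rewrite ler_wpM2l//; exact: gV al.
Qed.

Lemma bv_bound_cst (c : C) : bv_bound (fun=> c) (cabs c) 0.
Proof.
split=> // gamma v n t z _ _ _; rewrite mulr0 big1// => k _.
by rewrite subrr (_ : 0 = (0%:C)%C)// cabsR normr0.
Qed.

Lemma bv_bound_lip f h B Bf Vf (a : R) : bv_bound f Bf Vf -> 0 <= a ->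
  (forall z, cabs (h z) <= B) ->
  (forall z w, cabs (h z - h w) <= a * cabs (f z - f w)) ->
  bv_bound h B (a * Vf).
Proof.
move=> fV a0 hB hV; have := bv_bound_comb fV fV a0 (lexx 0) hB.
rewrite mul0r addr0; apply=> z w; rewrite mul0r addr0; exact: hV.
Qed.

Lemma bv_boundD f g Bf Vf Bg Vg : bv_bound f Bf Vf -> bv_bound g Bg Vg ->
  bv_bound (fun z => f z + g z) (Bf + Bg) (Vf + Vg).
Proof.
move=> fV gV; rewrite -[Vf]mul1r -[Vg]mul1r.
apply: (bv_bound_comb fV gV) => // [z|z w].
  by case: fV gV => [fB _ _] [gB _ _]; apply: le_trans (cabsD _ _) (lerD _ _).
by rewrite !mul1r opprD addrACA cabsD.
Qed.

Lemma bv_boundM f g Bf Vf Bg Vg : s !=set0 ->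
  bv_bound f Bf Vf -> bv_bound g Bg Vg ->
  bv_bound (fun z => f z * g z) (Bf * Bg) (Bg * Vf + Bf * Vg).
Proof.
move=> [z0 sz0] fV gV; have [fB _ _] := fV; have [gB _ _] := gV.
have B0 h B : (forall z, cabs (h z) <= B) -> 0 <= B.
  by move/(_ (SigSub (mem_set sz0))); apply: le_trans; exact: cabs_ge0.
apply: (bv_bound_comb fV gV); [exact: B0 gB|exact: B0 fB| |] => [z|z w].
  by rewrite cabsM ler_pM// cabs_ge0.
have -> : f z * g z - f w * g w = (f z - f w) * g z + f w * (g z - g w) by ring.
apply: le_trans (cabsD _ _) _; rewrite !cabsM mulrC lerD//.
  by rewrite ler_wpM2r ?cabs_ge0.
by rewrite ler_wpM2r ?cabs_ge0.
Qed.

Lemma bv_bound_monotone (l : C -> R) (phi : R -> R) (al be B : R) :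
  coordinate l -> al <= be -> {homo phi : x y / x <= y} ->
  (forall x, al <= phi x <= be) -> (forall x, `|phi x| <= B) ->
  bv_bound (fun z => ((phi (l (\val z)))%:C)%C) B (be - al).
Proof.
move=> lP albe phih phib phiB; split.
- by move=> z; rewrite cabsR.
- by rewrite subr_ge0.
move=> gamma v n t z gc vE [h1 h2 h3].
apply: le_trans (sum_along_monotone lP gc vE phih phib h1 h2).
rewrite [leLHS]big_nat_cond [leRHS]big_nat_cond; apply: ler_sum => k /andP[/andP[_ kn] _].
have k1n : (k.+1 < n)%N by move: kn; case: (n).
by rewrite -rmorphB cabsR !h3// ltnW.
Qed.

Lemma bv_bound_le f B V B' V' : bv_bound f B V -> B <= B' -> V <= V' ->
  bv_bound f B' V'.
Proof.
move=> [fB V0 fV] BB VV; split; first by move=> z; apply: le_trans BB.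
  exact: le_trans VV.
move=> gamma v n t z gc vE al; apply: le_trans (fV _ _ _ _ _ gc vE al) _.
by rewrite ler_wpM2l//; have := vf_real_ge0 vE; lra.
Qed.

End Bounds.

(** * Inverses in AC *)

Section Decay.
Variable R : realType.
Implicit Types rho : R.

Lemma exp_small rho A e : 0 <= rho < 1 -> 0 < e -> exists n, A * rho ^+ n < e.
Proof.
move=> /andP[r0 r1] e0.
have rn : `|rho| < 1 by rewrite ger0_norm.
have /cvgrPdist_lt/(_ e e0)[n _ /(_ n (leqnn n))] := cvg_geometric A rn.
by rewrite sub0r normrN => /(le_lt_trans (ler_norm _)) h; exists n.
Qed.

(** A bound on n rho^n that is uniform in n: (1 - rho) n rho^n is at most
    (1 - rho) (1 + rho + ... + rho^(n-1)). *)
Lemma nat_exp_le rho n : 0 <= rho < 1 -> n%:R * rho ^+ n * (1 - rho) <= 1 - rho ^+ n.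
Proof.
move=> /andP[r0 r1]; elim: n => [|n IH]; first by rewrite mul0r mul0r expr0 subrr.
rewrite -natr1 exprS.
have p0 : 0 <= rho ^+ n by rewrite exprn_ge0.
have p1 : rho ^+ n <= 1 by rewrite exprn_ile1// ltW.
move: (rho ^+ n) p0 p1 IH => p p0 p1 IH.
have := ler_wpM2l r0 IH.
have : 0 <= (1 - rho) * (1 - rho * p).
  by rewrite mulr_ge0// subr_ge0 ?(ltW r1)// mulr_ile1// ltW.
by move=> h1 h2; rewrite -subr_ge0; rewrite -subr_ge0 in h2; nra.
Qed.

(** The decay needed for powers, whose variation grows linearly in front of the
    exponential. *)
Lemma affine_exp_small rho A D e : 0 <= rho < 1 -> 0 <= A -> 0 <= D -> 0 < e ->
  exists n, rho ^+ n * (A + n.+1%:R * D) < e.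
Proof.
move=> rho01 A0 D0 e0; have /andP[r0 r1] := rho01.
have [n nP] := exp_small (A + D + 2 * (1 - rho)^-1 * D) rho01 e0.
(* Of the exponent n + n, one half absorbs the linear factor. *)
exists (n + n)%N; apply: le_lt_trans nP.
rewrite exprD -mulrA [leRHS]mulrC ler_wpM2l ?exprn_ge0//.
have p0 : 0 <= rho ^+ n by rewrite exprn_ge0.
have p1 : rho ^+ n <= 1 by rewrite exprn_ile1// ltW.
have np : n%:R * rho ^+ n <= (1 - rho)^-1.
  rewrite -[leRHS]mul1r ler_pdivlMr ?subr_gt0//; apply: le_trans (nat_exp_le n rho01) _.
  by lra.
rewrite -natr1 natrD.
have -> : rho ^+ n * (A + (n%:R + n%:R + 1) * D)
   = rho ^+ n * (A + D) + 2 * (n%:R * rho ^+ n) * D by ring.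
rewrite lerD//; first by rewrite ler_piMl// addr_ge0.
by rewrite ler_wpM2r// ler_wpM2l.
Qed.

End Decay.

Section AC.
Variables (R : realType) (s : set R[i]).
Hypotheses (s_neq0 : s !=set0) (s_compact : compact s).
Local Notation C := R[i].
Implicit Types (f g h : s -> C).

Lemma coordinate_bounded l : coordinate l ->
  exists2 M : R, 0 < M & forall z : s, `|l (\val z)| <= M.
Proof.
move=> [lc _].
have : compact (l @` s) by apply: continuous_compact => //; apply: continuous_subspaceT.
move=> /compact_bounded/ex_strict_bound_gt0[M M0 hM].
by exists M => // z; apply/ltW/hM; exists (\val z) => //; exact: set_valP.
Qed.

Definition clamp (M x : R) : R := Num.max (- M) (Num.min M x).

Lemma clamp_homo M : {homo clamp M : x y / x <= y}.
Proof.
move=> x y xy.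
have h : Num.min M x <= Num.min M y by rewrite le_min !ge_min lexx xy orbT.
by rewrite /clamp ge_max !le_max lexx h orbT.
Qed.

Lemma clamp_bound M x : 0 <= M -> - M <= clamp M x <= M.
Proof. by move=> M0; rewrite /clamp le_max lexx ge_max ge_min lexx/= andbT; lra. Qed.

Lemma clamp_id M x : `|x| <= M -> clamp M x = x.
Proof.
rewrite ler_norml => /andP[h1 h2]; rewrite /clamp (min_idPr _)//.
by apply/max_idPr.
Qed.

Lemma bv_bound_clamp l (a M : R) : coordinate l -> 0 <= M ->
  bv_bound (fun z : s => ((clamp M (l (\val z) - a))%:C)%C) M (M + M).
Proof.
move=> lP M0; have -> : M + M = M - - M by rewrite opprK.
apply: (@bv_bound_monotone _ _ l (fun x => clamp M (x - a)) (- M) M M) => //.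
- lra.
- by move=> x y xy; apply: clamp_homo; rewrite lerD2r.
- by move=> x; exact: clamp_bound.
- by move=> x; rewrite ler_norml clamp_bound.
Qed.

Lemma bv_bound_coordinate l : coordinate l ->
  exists M, bv_bound (fun z : s => ((l (\val z))%:C)%C) M (M + M).
Proof.
move=> lP; have [M M0 lM] := coordinate_bounded lP.
exists M; have := bv_bound_clamp 0 lP (ltW M0); congr (bv_bound _ M (M + M)).
by apply/funext => z; rewrite subr0 clamp_id.
Qed.

(** Without one closed subalgebra containing the generators, the intersection
    that defines AC would be everything; BV is such a subalgebra. *)
Lemma BV_subalgebra : closed_subalgebra (@BV R s).
Proof.
split=> //.
- by have := bv_bound_BV (bv_bound_cst s (0 : C)).
- move=> a f g /(BV_bv_bound s_neq0)[Bf [Vf fV]] /(BV_bv_bound s_neq0)[Bg [Vg gV]].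
  exact: bv_bound_BV (bv_boundD (bv_boundM s_neq0 (bv_bound_cst s a) fV) gV).
- move=> f g /(BV_bv_bound s_neq0)[Bf [Vf fV]] /(BV_bv_bound s_neq0)[Bg [Vg gV]].
  exact: bv_bound_BV (bv_boundM s_neq0 fV gV).
Qed.

Lemma lambda_BV : BV (@lambda R s).
Proof.
have [M MP] := bv_bound_coordinate (Re_coordinate R).
have [N NP] := bv_bound_coordinate (Im_coordinate R).
have := bv_boundD MP (bv_boundM s_neq0 (bv_bound_cst s 'i%C) NP).
move/bv_bound_BV; congr (BV _).
by apply/funext => z; rewrite /lambda [in RHS](complexE (\val z)).
Qed.

Lemma lambda_bar_BV : BV (@lambda_bar R s).
Proof.
have [B [V [lB V0 lV]]] := BV_bv_bound s_neq0 lambda_BV.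
have cc z : (z ^*)%R = (z^*)%C :> C by [].
apply: (@bv_bound_BV _ _ _ B V); split=> // [z|gamma v n t z gc vE al].
  by rewrite /lambda_bar cabs_conj; exact: lB.
apply: le_trans (lV _ _ _ _ _ gc vE al); apply: ler_sum => k _.
by rewrite /lambda_bar -rmorphB cabs_conj.
Qed.

Lemma ACfun_subalgebra : closed_subalgebra (@ACfun R s).
Proof.
split.
- apply: smallest_sub; first exact: BV_subalgebra.
  move=> _ [[->|->]|->]; [|exact: lambda_BV|exact: lambda_bar_BV].
  exact: bv_bound_BV (bv_bound_cst s (1 : C)).
- by move=> A [[]].
- move=> a f g fA gA A AP; have [[_ _ h _ _] _] := AP.
  by apply: h; [exact: fA|exact: gA].
- move=> f g fA gA A AP; have [[_ _ _ h _] _] := AP.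
  by apply: h; [exact: fA|exact: gA].
- move=> f fBV fA A AP; have [[_ _ _ _ h] _] := AP.
  apply: h => // e e0; have [g gA ge] := fA e e0.
  by exists g => //; exact: gA.
Qed.

Lemma AC1 : ACfun (1 : s -> C).
Proof. by move=> A [_ sub]; apply: sub; left; left. Qed.

Lemma AC0 : ACfun (fun _ : s => 0 : C).
Proof. by have [_] := ACfun_subalgebra. Qed.

Lemma AC_lambda : ACfun (@lambda R s).
Proof. by move=> A [_ sub]; apply: sub; left; right. Qed.

Lemma AC_lambda_bar : ACfun (@lambda_bar R s).
Proof. by move=> A [_ sub]; apply: sub; right. Qed.

Lemma AC_lin (a : C) f g : ACfun f -> ACfun g -> ACfun (fun z => a * f z + g z).
Proof. by have [_ _ h _ _] := ACfun_subalgebra; exact: h. Qed.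

Lemma ACM f g : ACfun f -> ACfun g -> ACfun (fun z => f z * g z).
Proof. by have [_ _ _ h _] := ACfun_subalgebra; exact: h. Qed.

Lemma ACZ (a : C) f : ACfun f -> ACfun (fun z => a * f z).
Proof.
move=> fA; have := AC_lin a fA AC0; congr (@ACfun R s _).
by apply/funext => z; rewrite addr0.
Qed.

Lemma ACD f g : ACfun f -> ACfun g -> ACfun (fun z => f z + g z).
Proof.
move=> fA gA; have := AC_lin 1 fA gA; congr (@ACfun R s _).
by apply/funext => z; rewrite mul1r.
Qed.

Lemma ACB f g : ACfun f -> ACfun g -> ACfun (fun z => f z - g z).
Proof.
move=> fA gA; have := AC_lin (-1) gA fA; congr (@ACfun R s _).
by apply/funext => z; rewrite mulN1r addrC.
Qed.

Lemma AC_cst (c : C) : ACfun (fun _ : s => c).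
Proof.
have := ACZ c AC1; congr (@ACfun R s _); by apply/funext => z; rewrite mulr1.
Qed.

Lemma AC_bv_bound f : ACfun f -> exists B V, bv_bound f B V.
Proof.
move=> fA; have [sub _ _ _ _] := ACfun_subalgebra.
exact: BV_bv_bound s_neq0 (sub _ fA).
Qed.

Lemma AC_limit f B V : bv_bound f B V ->
  (forall e, 0 < e -> exists g B' V',
     [/\ ACfun g, bv_bound (fun z => f z - g z) B' V' & B' + V' < e]) ->
  ACfun f.
Proof.
move=> fV fA; have [_ _ _ _ h] := ACfun_subalgebra.
apply: h; first exact: bv_bound_BV fV.
move=> e e0; have [g [B' [V' [gA gV ge]]]] := fA e e0.
by exists g => //; apply: le_lt_trans (BVnorm_le gV) _; rewrite lte_fin.
Qed.

(** The Leibniz rule: the variation of a power carries the factor n, so the norms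
    of the powers of u decay as soon as the supremum rho of u is below 1. *)
Lemma bv_bound_exp (u : s -> C) rho V n : bv_bound u rho V ->
  bv_bound (fun z => u z ^+ n.+1) (rho ^+ n.+1) (n.+1%:R * rho ^+ n * V).
Proof.
move=> uV; elim: n => [|n IH].
  by rewrite expr1 expr0 !mul1r; move: uV; congr (@bv_bound R s _ _ _); apply/funext.
have := bv_boundM s_neq0 uV IH; congr (@bv_bound R s _ _ _).
by rewrite -[in RHS]natr1 [in RHS]exprS exprS; ring.
Qed.

(** After division by an upper bound M, the function is 1 - u with u between 0 and
    rho < 1. The remainder of the geometric series for its inverse is u^n times
    the inverse, which is in BV; the inverse itself is therefore a limit, in the
    BV norm, of polynomials in the function. *)
Lemma AC_inv (r : s -> R) (c : R) : 0 < c -> (forall z, c <= r z) ->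
  ACfun (fun z => ((r z)%:C)%C) -> ACfun (fun z => (((r z)^-1)%:C)%C).
Proof.
move=> c0 cr rA; have [B [V rV]] := AC_bv_bound rA; have [rB V0 _] := rV.
pose M := Num.max c B.
have rM z : r z <= M.
  rewrite le_max; apply/orP; right; apply: le_trans (rB z).
  by rewrite cabsR ler_norm.
have cM : c <= M by rewrite le_max lexx.
have M0 : 0 < M by lra.
have r0 z : 0 < r z by exact: lt_le_trans (cr z).
pose u z := ((1 - r z / M)%:C)%C; pose rho := 1 - c / M.
have rho01 : 0 <= rho < 1.
  by rewrite /rho subr_ge0 ler_pdivrMr// mul1r cM/= ltrBlDr ltrDl divr_gt0.
have /andP[rho0 rho1] := rho01.
have uA : ACfun u.
  have := ACB (AC_cst 1) (ACZ ((M^-1)%:C)%C rA); congr (@ACfun R s _).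
  by apply/funext => z; rewrite /u -rmorphM -(rmorph1 (real_complex R)) -rmorphB mulrC.
have uV : bv_bound u rho (M^-1 * V).
  apply: (bv_bound_lip rV); first by rewrite invr_ge0 ltW.
    move=> z; rewrite cabsR ger0_norm; first by rewrite lerD2l lerN2 ler_wpM2r// invr_ge0 ltW.
    by rewrite subr_ge0 ler_pdivrMr// mul1r.
  move=> z w; rewrite -!rmorphB !cabsR.
  have -> : 1 - r z / M - (1 - r w / M) = - (M^-1 * (r z - r w)) by ring.
  by rewrite normrN normrM (@ger0_norm _ M^-1)// invr_ge0 ltW.
have fV : bv_bound (fun z => (((r z)^-1)%:C)%C) c^-1 (c^-1 ^+ 2 * V).
  apply: (bv_bound_lip rV); first by rewrite exprn_ge0// invr_ge0 ltW.
    move=> z; rewrite cabsR gtr0_norm ?invr_gt0// lef_pV2 ?posrE//.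
  move=> z w; rewrite -!rmorphB !cabsR.
  have -> : (r z)^-1 - (r w)^-1 = - ((r z)^-1 * (r w)^-1 * (r z - r w)).
    by field; rewrite !gt_eqF.
  rewrite normrN normrM ler_wpM2r// gtr0_norm ?mulr_gt0 ?invr_gt0// expr2.
  by rewrite ler_pM ?invr_ge0 ?(ltW (r0 _))// lef_pV2 ?posrE.
apply: (AC_limit fV) => e e0.
have c10 : 0 <= c^-1 by rewrite invr_ge0 ltW.
have M10 : 0 <= M^-1 by rewrite invr_ge0 ltW.
have [n nP] := affine_exp_small (A := c^-1 + c^-1 ^+ 2 * V) (D := c^-1 * (M^-1 * V))
  rho01 (addr_ge0 c10 (mulr_ge0 (exprn_ge0 2 c10) V0)) (mulr_ge0 c10 (mulr_ge0 M10 V0)) e0.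
pose S k z := ((M^-1)%:C)%C * \sum_(0 <= j < k) u z ^+ j.
have SA k : ACfun (S k).
  apply: ACZ; elim: k => [|k IH].
    by have := AC0; congr (@ACfun R s _); apply/funext => z; rewrite big_nil.
  have ukA : ACfun (fun z => u z ^+ k).
    elim: (k) => [|j IHj]; first exact: AC1.
    have := ACM uA IHj; congr (@ACfun R s _); by apply/funext => z; rewrite exprS.
  have := ACD IH ukA; congr (@ACfun R s _).
  by apply/funext => z; rewrite big_nat_recr.
have := bv_boundM s_neq0 fV (bv_bound_exp n uV).
set B1 := (_ * _ ^+ _); set V1 := (_ + _ * (_ * _)) => eV.
exists (S n.+1), B1, V1; split; first exact: SA.
  move: eV; congr (@bv_bound R s _ _ _); apply/funext => z; rewrite /S.
  have Mr : ((M^-1)%:C)%C = (((r z)^-1)%:C)%C * (1 - u z).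
    rewrite /u -(rmorph1 (real_complex R)) -rmorphB -rmorphM; congr (_ %:C)%C.
    by field; rewrite !gt_eqF.
  have geo : (1 - u z) * \sum_(0 <= j < n.+1) u z ^+ j = 1 - u z ^+ n.+1.
    by rewrite big_mkord -(opprB (u z)) mulNr -subrX1 opprB.
  by rewrite Mr -mulrA geo; ring.
apply: le_lt_trans nP.
rewrite /B1 /V1 exprS.
have p0 : 0 <= rho ^+ n by rewrite exprn_ge0.
have h1 : rho * rho ^+ n <= rho ^+ n by rewrite ler_piMl// ltW.
set p := rho ^+ n in p0 h1 *.
have h2 := ler_wpM2l c10 h1.
have h3 := ler_wpM2l (mulr_ge0 (exprn_ge0 2 c10) V0) h1.
have -> : p * (c^-1 + c^-1 ^+ 2 * V + n.+1%:R * (c^-1 * (M^-1 * V))) =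
  c^-1 * p + (c^-1 ^+ 2 * V * p + c^-1 * (n.+1%:R * p * (M^-1 * V))) by ring.
rewrite lerD// lerD2r; apply: le_trans h3.
by rewrite mulrC.
Qed.

End AC.

(** * Piecewise linear functions in AC *)

Section Heron.
Variables (R : realType) (M : R).
Hypothesis M0 : 0 < M.

(** The iterates r' = (r + x^2 / r) / 2 of the square root algorithm for x^2,
    started at M, are rational functions of x^2; for x in [0, M], heron_err is
    their distance r - x to the limit x. The recursion for this distance shows
    that it decreases in x and is at least halved at each step: it then tends
    to 0 in variation as well as uniformly. *)
Fixpoint heron_err n (x : R) : R :=
  if n is n'.+1 then (heron_err n' x) ^+ 2 / (2 * (heron_err n' x + x))
  else Num.max (M - x) 0.

(** The lower bound keeps the iterates away from 0, which their inversion in AC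
    requires. *)
Lemma heron_pos n x : 0 <= x ->
  0 <= heron_err n x /\ M / 2 ^+ n <= heron_err n x + x.
Proof.
move=> x0; elim: n => [|n [IH1 IH2]] /=.
  rewrite le_max lexx orbT expr0 divr1; split=> //.
  by rewrite -lerBlDr le_max lexx.
have r0 : 0 < heron_err n x + x.
  by apply: lt_le_trans IH2; rewrite divr_gt0// exprn_gt0.
split; first by rewrite divr_ge0 ?sqr_ge0 ?mulr_ge0// ltW.
move: (heron_err n x) IH1 IH2 r0 => d IH1 IH2 r0.
have -> : d ^+ 2 / (2 * (d + x)) + x = ((d + x) / 2) + x ^+ 2 / (2 * (d + x)).
  by field; rewrite gt_eqF.
have : 0 <= x ^+ 2 / (2 * (d + x)) by rewrite divr_ge0 ?sqr_ge0// mulr_ge0// ltW.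
have -> : M / 2 ^+ n.+1 = (M / 2 ^+ n) / 2.
  by rewrite exprS; field; rewrite expf_neq0.
by move=> ?; lra.
Qed.

Lemma heron_den n x : 0 <= x -> 0 < heron_err n x + x.
Proof.
move=> x0; have [_] := heron_pos n x0; apply: lt_le_trans.
by rewrite divr_gt0// exprn_gt0.
Qed.

Lemma heron_le n x : 0 <= x -> heron_err n x <= M / 2 ^+ n.
Proof.
move=> x0; elim: n => [|n IH] /=.
  by rewrite expr0 divr1 ge_max (ltW M0) andbT; lra.
have [d0 _] := heron_pos n x0; have r0 := heron_den n x0.
have -> : M / 2 ^+ n.+1 = (M / 2 ^+ n) / 2.
  by rewrite exprS; field; rewrite expf_neq0.
apply: le_trans (_ : heron_err n x / 2 <= _); last by lra.
rewrite ler_pdivrMr ?mulr_gt0//; move: (heron_err n x) d0 r0 => d d0 r0.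
by have : 0 <= d * x by [rewrite mulr_ge0]; nra.
Qed.

Lemma heron_anti n x y : 0 <= x -> x <= y -> heron_err n y <= heron_err n x.
Proof.
move=> x0 xy; have y0 := le_trans x0 xy; elim: n => [|n IH] /=.
  by rewrite ge_max !le_max lexx orbT andbT lerD2l lerN2 xy.
have [d0 _] := heron_pos n x0; have r0 := heron_den n x0.
have [e0 _] := heron_pos n y0; have s0 := heron_den n y0.
move: (heron_err n x) (heron_err n y) IH d0 r0 e0 s0 => d e ed d0 r0 e0 s0.
rewrite ler_pdivrMr ?mulr_gt0// mulrAC ler_pdivlMr ?mulr_gt0//.
have h1 : 0 <= d * e * (d - e) by rewrite !mulr_ge0// subr_ge0.
have h2 : e ^+ 2 * x <= d ^+ 2 * y.
  by rewrite ler_pM ?sqr_ge0// ler_sqr ?nnegrE.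
by nra.
Qed.

End Heron.

Section PiecewiseLinear.
Variables (R : realType) (s : set R[i]).
Hypotheses (s_neq0 : s !=set0) (s_compact : compact s).
Local Notation C := R[i].
Local Notation real f := (fun z : s => ((f (\val z))%:C)%C).

Lemma AC_Re : ACfun (real (@complex.Re R)).
Proof.
have := ACZ s_neq0 s_compact 2^-1
  (ACD s_neq0 s_compact (AC_lambda (s := s)) (AC_lambda_bar (s := s))).
congr (@ACfun R s _).
by apply/funext => z; rewrite ReJ_add mulrC.
Qed.

Lemma AC_Im : ACfun (real (@complex.Im R)).
Proof.
have := ACZ s_neq0 s_compact ('i%C / 2)
  (ACB s_neq0 s_compact (AC_lambda_bar (s := s)) (AC_lambda (s := s))).
congr (@ACfun R s _).
by apply/funext => z; rewrite ImJ_sub /lambda /lambda_bar; ring.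
Qed.

Section OneCoordinate.
Variables (l : C -> R) (lP : coordinate l) (lA : ACfun (real l)).

(** A decreasing function of |x - a| is, up to a constant, the sum of a monotone
    function of max(0, x - a) and one of max(0, a - x). *)
Lemma bv_bound_heron M n a : 0 < M ->
  bv_bound (real (fun z => heron_err M n `|l z - a|)) (M / 2 ^+ n)
    (1 * (M / 2 ^+ n) + 1 * (M / 2 ^+ n)).
Proof.
move=> M0; set d := M / 2 ^+ n.
have d0 : 0 <= d by rewrite divr_ge0 ?ltW// exprn_gt0.
pose p x := - heron_err M n (Num.max 0 (x - a)).
pose q x := heron_err M n (Num.max 0 (a - x)).
have m0 y : 0 <= Num.max 0 y :> R by rewrite le_max lexx.
have hb y : 0 <= heron_err M n (Num.max 0 y) <= d.
  by rewrite heron_le// andbT; have [] := heron_pos M0 n (m0 y).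
have pV : bv_bound (real (fun z => p (l z))) d d.
  rewrite -{2}[d]add0r -{2}[d]opprK.
  apply: (@bv_bound_monotone _ _ l p (- d) 0 d) => //.
  - by rewrite oppr_le0.
  - move=> x y xy; rewrite lerN2 heron_anti//.
    by rewrite ge_max !le_max lexx lerD2r xy orbT.
  - by move=> x; rewrite lerN2 oppr_le0 andbC hb.
  - by move=> x; rewrite /p normrN; have /andP[h1 h2] := hb (x - a); rewrite ger0_norm.
have qV : bv_bound (real (fun z => q (l z))) d d.
  rewrite -{2}[d]subr0.
  apply: (@bv_bound_monotone _ _ l q 0 d d) => //.
  - move=> x y xy; rewrite heron_anti//.
    by rewrite ge_max !le_max lexx lerD2l lerN2 xy orbT.
  - by move=> x; exact: hb.
  - by move=> x; have /andP[h1 h2] := hb (a - x); rewrite ger0_norm.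
have abs_eq x : heron_err M n `|x - a| = q x - p x - heron_err M n 0.
  rewrite /p /q; have [h|h] := leP 0 (x - a).
    rewrite ger0_norm// (max_idPl _); last lra.
    by ring.
  rewrite ltr0_norm// opprB (max_idPr _); last lra.
  by ring.
apply: (bv_bound_comb pV qV) => // [z|z w].
  by rewrite cabsR; have [h _] := heron_pos M0 n (normr_ge0 (l (\val z) - a));
    rewrite ger0_norm// heron_le.
rewrite -!rmorphB !cabsR !abs_eq !mul1r.
set pz := p _; set qz := q _; set pw := p _; set qw := q _.
have -> : qz - pz - heron_err M n 0 - (qw - pw - heron_err M n 0)
  = - (pz - pw) + (qz - qw) by ring.
by apply: le_trans (ler_normD _ _) _; rewrite normrN.
Qed.

(** The absolute value is not a polynomial, but it is the limit in variation of
    the Heron iterates, which are in AC because AC contains inverses. Every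
    piecewise linear function of a coordinate follows. *)
Lemma AC_abs a : ACfun (real (fun z => `|l z - a|)).
Proof.
have [N N0 lN] := coordinate_bounded s_compact lP.
pose M := N + `|a|.
have M0 : 0 < M by rewrite /M ltr_pwDl.
have uM (z : s) : `|l (\val z) - a| <= M.
  by apply: le_trans (ler_normB _ _) _; rewrite lerD2r.
have uA : ACfun (real (fun z => l z - a)).
  have := ACB s_neq0 s_compact lA (AC_cst s_neq0 s_compact (a%:C)%C).
  by congr (@ACfun R s _); apply/funext => z; rewrite -rmorphB.
have rA n : ACfun (real (fun z => heron_err M n `|l z - a| + `|l z - a|)).
  elim: n => [|n IH].
    have := AC_cst s_neq0 s_compact (M%:C)%C.
    congr (@ACfun R s _); apply/funext => z /=; congr (_%:C)%C.
    by rewrite (max_idPl _) ?subrK// subr_ge0 uM.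
  have inv := @AC_inv R s s_neq0 s_compact
    (fun z => heron_err M n `|l (\val z) - a| + `|l (\val z) - a|) (M / 2 ^+ n).
  have {}inv := inv (divr_gt0 M0 (exprn_gt0 n (ltr0n R 2)))
    (fun z => (heron_pos M0 n (normr_ge0 _)).2) IH.
  have := ACZ s_neq0 s_compact 2^-1 (ACD s_neq0 s_compact IH
     (ACM s_neq0 s_compact (ACM s_neq0 s_compact uA uA) inv)).
  congr (@ACfun R s _); apply/funext => z /=.
  have r0 := heron_den M0 n (normr_ge0 (l (\val z) - a)).
  rewrite -!rmorphM -rmorphD.
  have -> : (2^-1 : C) = ((2^-1 : R)%:C)%C by rewrite fmorphV rmorph_nat.
  rewrite -rmorphM; congr (_%:C)%C.
  have -> : (l (\val z) - a) * (l (\val z) - a) = `|l (\val z) - a| ^+ 2.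
    by rewrite -expr2 real_normK ?num_real.
  by field; rewrite gt_eqF.
have [L LV] := bv_bound_coordinate s_compact lP.
have absV : bv_bound (real (fun z => `|l z - a|)) M (1 * (L + L)).
  apply: (bv_bound_lip LV) => // [z|z w]; first by rewrite cabsR normr_id.
  rewrite mul1r -!rmorphB !cabsR.
  have -> : l (\val z) - l (\val w) = (l (\val z) - a) - (l (\val w) - a) by ring.
  exact: ler_dist_dist.
apply: (AC_limit s_neq0 s_compact absV) => e e0.
have [n nP] : exists n, (3 * M) * 2^-1 ^+ n < e.
  by apply: exp_small => //; apply/andP; split; lra.
have := bv_bound_heron n a M0 => hV.
exists (real (fun z => heron_err M n `|l z - a| + `|l z - a|)), (M / 2 ^+ n),
  (1 * (1 * (M / 2 ^+ n) + 1 * (M / 2 ^+ n))); split=> //.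
  have [hB _ _] := hV.
  apply: (bv_bound_lip hV) => // [z|z w].
    apply: le_trans (hB z); rewrite -rmorphB !cabsR opprD addrCA subrr addr0.
    by rewrite normrN.
  rewrite mul1r -!rmorphB !cabsR -[leRHS]normrN.
  by rewrite le_eqVlt; apply/orP; left; apply/eqP; congr (`| _ |); ring.
apply: le_lt_trans nP; rewrite exprVn; lra.
Qed.

Lemma AC_clamp a d : 0 <= d -> ACfun (real (fun z => clamp d (l z - a))).
Proof.
move=> d0.
have := ACZ s_neq0 s_compact 2^-1 (ACB s_neq0 s_compact (AC_abs (a - d)) (AC_abs (a + d))).
congr (@ACfun R s _); apply/funext => z /=.
have -> : (2^-1 : C) = ((2^-1 : R)%:C)%C by rewrite fmorphV rmorph_nat.
rewrite -rmorphB -rmorphM; congr (_%:C)%C; move: (l _) => x.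
rewrite /clamp; case: (leP d (x - a)) => h1.
  rewrite (max_idPr _); last lra.
  by rewrite !ger0_norm; lra.
case: (leP (- d) (x - a)) => h2.
  by rewrite ger0_norm ?ler0_norm; lra.
by rewrite !ler0_norm; lra.
Qed.

End OneCoordinate.

(** The trapezium equal to 1 on [-d/2, d/2] and to 0 outside ]-d, d[. As a
    difference of two translates of a clamp it is in AC at once. *)
Definition plateau (d x : R) : R :=
  2 / d * (clamp (d / 4) (x + 3 * d / 4) - clamp (d / 4) (x - 3 * d / 4)).

Lemma plateau_ge0 d x : 0 < d -> 0 <= plateau d x.
Proof.
move=> d0; apply: mulr_ge0; first by rewrite divr_ge0// ltW.
by rewrite subr_ge0; apply: clamp_homo; lra.
Qed.

Lemma clamp_ge (M x : R) : 0 <= M -> M <= x -> clamp M x = M.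
Proof. by move=> M0 Mx; rewrite /clamp (min_idPl Mx); apply/max_idPr; lra. Qed.

Lemma clamp_le (M x : R) : 0 <= M -> x <= - M -> clamp M x = - M.
Proof. by move=> M0 Mx; rewrite /clamp; apply/max_idPl; rewrite ge_min Mx orbT. Qed.

Lemma plateau1 d x : 0 < d -> `|x| <= d / 2 -> plateau d x = 1.
Proof.
move=> d0; rewrite ler_norml => /andP[h1 h2].
rewrite /plateau clamp_ge; [|lra|lra]; rewrite clamp_le; [|lra|lra].
by field; rewrite gt_eqF.
Qed.

Lemma plateau0 d x : 0 < d -> d <= `|x| -> plateau d x = 0.
Proof.
move=> d0; rewrite ler_normr => /orP[h|h].
  rewrite /plateau clamp_ge; [|lra|lra]; rewrite clamp_ge; [|lra|lra].
  by rewrite subrr mulr0.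
rewrite /plateau clamp_le; [|lra|lra]; rewrite clamp_le; [|lra|lra].
by rewrite subrr mulr0.
Qed.

Lemma AC_plateau l a d : coordinate l -> ACfun (real l) -> 0 < d ->
  ACfun (real (fun z => plateau d (l z - a))).
Proof.
move=> lP lA d0.
have d40 : 0 <= d / 4 by lra.
have := ACZ s_neq0 s_compact ((2 / d)%:C)%C (ACB s_neq0 s_compact
  (AC_clamp lP lA (a - 3 * d / 4) d40) (AC_clamp lP lA (a + 3 * d / 4) d40)).
congr (@ACfun R s _); apply/funext => z /=.
rewrite -rmorphB -rmorphM; congr (_%:C)%C; rewrite /plateau.
by congr (_ * (clamp _ _ - clamp _ _)); ring.
Qed.

Definition square (w : C) (d : R) : set C :=
  [set z | `|complex.Re z - complex.Re w| < d /\ `|complex.Im z - complex.Im w| < d].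

Definition square_plateau (w : C) (d : R) (z : C) : R :=
  plateau d (complex.Re z - complex.Re w) * plateau d (complex.Im z - complex.Im w).

Lemma square_plateau_ge0 w d z : 0 < d -> 0 <= square_plateau w d z.
Proof. by move=> d0; rewrite mulr_ge0// plateau_ge0. Qed.

Lemma square_plateau1 w d z : 0 < d -> square w (d / 2) z -> square_plateau w d z = 1.
Proof. by move=> d0 [h1 h2]; rewrite /square_plateau !plateau1 ?mulr1// ltW. Qed.

Lemma square_plateau0 w d z : 0 < d -> ~ square w d z -> square_plateau w d z = 0.
Proof.
move=> d0 h; rewrite /square_plateau.
have [h1|h1] := ltP `|complex.Re z - complex.Re w| d; last first.
  by rewrite plateau0// mul0r.
have [h2|h2] := ltP `|complex.Im z - complex.Im w| d; last first.
  by rewrite [X in _ * X]plateau0// mulr0.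
by case: h.
Qed.

Lemma AC_square_plateau w d : 0 < d -> ACfun (real (square_plateau w d)).
Proof.
move=> d0.
have := ACM s_neq0 s_compact (AC_plateau (complex.Re w) (Re_coordinate R) AC_Re d0)
  (AC_plateau (complex.Im w) (Im_coordinate R) AC_Im d0).
by congr (@ACfun R s _); apply/funext => z; rewrite -rmorphM.
Qed.

(** A function that agrees with z - w on the square and is small in the BV norm:
    the norm is at most 6 d, whereas z - w itself has a norm independent of d. *)
Definition local_id (w : C) (d : R) (z : C) : C :=
  ((clamp d (complex.Re z - complex.Re w))%:C)%C +
  'i%C * ((clamp d (complex.Im z - complex.Im w))%:C)%C.

Lemma local_idE w d z : square w d z -> local_id w d z = z - w.
Proof.
move=> [h1 h2]; rewrite /local_id !clamp_id ?ltW//.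
by rewrite -!raddfB -complexE.
Qed.

Lemma AC_local_id w d : 0 <= d -> ACfun (fun z : s => local_id w d (\val z)).
Proof.
move=> d0; apply: (ACD s_neq0 s_compact).
  exact: (AC_clamp (Re_coordinate R) AC_Re).
by apply: (ACZ s_neq0 s_compact); exact: (AC_clamp (Im_coordinate R) AC_Im).
Qed.

Lemma bv_bound_local_id w d : 0 <= d ->
  bv_bound (fun z : s => local_id w d (\val z)) (2 * d) (4 * d).
Proof.
move=> d0.
have i1 : cabs ('i%C : C) = 1.
  by apply: complexI; rewrite cabsE complexiE normCi.
have := bv_boundD (bv_bound_clamp s (complex.Re w) (Re_coordinate R) d0)
  (bv_boundM s_neq0 (bv_bound_cst s 'i%C) (bv_bound_clamp s (complex.Im w) (Im_coordinate R) d0)).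
move/bv_bound_le; apply; rewrite i1; lra.
Qed.

End PiecewiseLinear.

(** * Partitions of unity *)

Section Squares.
Variable R : realType.
Local Notation C := R[i].

Definition closed_square (w : C) (d : R) : set C :=
  [set z | `|complex.Re z - complex.Re w| <= d /\ `|complex.Im z - complex.Im w| <= d].

Lemma square_open w d : open (@square R w d).
Proof.
have oc l : coordinate l -> open [set z : C | `|l z - l w| < d].
  move=> [lc _].
  have -> : [set z : C | `|l z - l w| < d] = l @^-1` `]l w - d, l w + d[.
    by apply/seteqP; split=> z /=; rewrite in_itv/= -ltr_distl.
  by apply: open_comp => [z _|]; [exact: lc|exact: itv_open].
exact: openI (oc _ (Re_coordinate R)) (oc _ (Im_coordinate R)).
Qed.

Lemma closed_square_closed w d : closed (closed_square w d).
Proof.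
have oc l : coordinate l -> closed [set z : C | `|l z - l w| <= d].
  move=> [lc _].
  have -> : [set z : C | `|l z - l w| <= d] = l @^-1` `[l w - d, l w + d].
    by apply/seteqP; split=> z /=; rewrite in_itv/= -ler_distl.
  by apply: closed_comp => [z _|]; [exact: lc|exact: itv_closed].
exact: closedI (oc _ (Re_coordinate R)) (oc _ (Im_coordinate R)).
Qed.

Lemma square_center (w : C) d : 0 < d -> square w d w.
Proof. by move=> d0; split; rewrite subrr normr0. Qed.

Lemma open_square_sub (U : set C) w : open U -> U w ->
  exists2 d, 0 < d & square w d `<=` U.
Proof.
move=> oU Uw; have /nbhs_ballP[e /= e0 eU] := open_nbhs_nbhs (conj oU Uw).
have eE : e = ((complex.Re e)%:C)%C by rewrite RRe_real// gtr0_real.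
have e0' : 0 < complex.Re e by rewrite -ltcR -eE.
exists (complex.Re e / 2) => [|z [h1 h2]]; first by rewrite divr_gt0.
apply: eU; rewrite -ball_normE /ball_/= eE -cabsE ltcR.
apply: le_lt_trans (cabs_le_ReIm _) _.
by rewrite !raddfB/= distrC [X in _ + X]distrC; lra.
Qed.

Lemma closed_squareS (w : C) d e : d < e -> closed_square w d `<=` square w e.
Proof. by move=> de z [h1 h2]; split; apply: le_lt_trans de. Qed.

End Squares.

Section Localisation.
Variables (R : realType) (s : set R[i]).
Hypotheses (s_neq0 : s !=set0) (s_compact : compact s).
Local Notation C := R[i].

(** The use made of partitions of unity: a property that is additive, and holds for
    the functions carried by small squares around each point of the compact set,
    holds for all of AC. A finite cover by half-size squares is removed one
    square at a time, splitting f as f chi + f (1 - chi) with chi the plateau of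
    that square. *)
Lemma AC_localisation (P : (s -> C) -> Prop) :
  P (fun=> 0) ->
  (forall f g, ACfun f -> ACfun g -> P f -> P g -> P (fun z => f z + g z)) ->
  (forall w, s w -> exists2 d, 0 < d & forall f, ACfun f ->
      (forall z : s, ~ square w d (\val z) -> f z = 0) -> P f) ->
  forall f, ACfun f -> P f.
Proof.
move=> P0 PD Ploc.
have radius w : exists d, s w -> 0 < d /\ forall f, ACfun f ->
    (forall z : s, ~ square w d (\val z) -> f z = 0) -> P f.
  have [sw|nsw] := pselect (s w); last by exists 0.
  by have [d d0 dP] := Ploc w sw; exists d.
have [d dP] := choice radius.
have [D' D's cov] : finite_subset_cover s (fun w => square w (d w / 2)) s.
  move: s_compact; rewrite compact_cover; apply => [w sw|w sw].
    exact: square_open.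
  by exists w => //; apply: square_center; have [? _] := dP w sw; rewrite divr_gt0.
have main (L : seq C) : (forall w, w \in L -> s w) -> forall f, ACfun f ->
    (forall z : s, (forall w, w \in L -> ~ square w (d w / 2) (\val z)) -> f z = 0) -> P f.
  elim: L => [|w L IH] Ls f fA fL.
    by rewrite (_ : f = fun=> 0)//; apply/funext => z; exact: fL.
  have sw : s w by apply: Ls; rewrite mem_head.
  have [d0 wP] := dP w sw.
  pose chi (z : s) : C := ((square_plateau w (d w) (\val z))%:C)%C.
  have chiA : ACfun chi by exact: AC_square_plateau.
  rewrite (_ : f = fun z => f z * chi z + f z * (1 - chi z)); last first.
    by apply/funext => z; ring.
  have fchiA : ACfun (fun z => f z * chi z) by exact: ACM.
  have fchiA' : ACfun (fun z => f z * (1 - chi z)).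
    by apply: ACM => //; apply: ACB => //; exact: AC_cst.
  apply: PD => //.
    apply: wP => // z h; by rewrite /chi square_plateau0// mulr0.
  apply: IH => // [u uL|z h]; first by apply: Ls; rewrite in_cons uL orbT.
  have [zw|zw] := pselect (square w (d w / 2) (\val z)).
    by rewrite /chi square_plateau1// subrr mulr0.
  rewrite fL ?mul0r// => u; rewrite in_cons => /orP[/eqP -> //|]; exact: h.
move=> f fA; apply: (main (enum_fset D')) => // [w wD|z h].
  by have := D's w wD; rewrite inE.
have [w wD wz] := cov (\val z) (set_valP z); by case: (h w wD).
Qed.

End Localisation.

(** * Spectral spaces of the functional calculus *)

Lemma mul_conj_sub (R : realType) (z w : R[i]) : (z - w) * (z^* - w^*)%C =
  (((complex.Re z - complex.Re w) ^+ 2 + (complex.Im z - complex.Im w) ^+ 2)%:C)%C.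
Proof. by rewrite -rmorphB -sqr_normc -add_Re2_Im2 !raddfB. Qed.

Section VectorNorm.
Variables (R : realType) (X : completeNormedModType R[i]).
Local Notation C := R[i].

(** The norm of X takes its values in R[i], where the order is only partial. *)
Definition vnorm (x : X) : R := complex.Re `|x|.

Lemma vnormE x : ((vnorm x)%:C)%C = `|x|.
Proof. by rewrite /vnorm RRe_real// normr_real. Qed.

Lemma vnorm_ge0 x : 0 <= vnorm x.
Proof. by rewrite -ler0c vnormE normr_ge0. Qed.

Lemma vnormZ (a : C) x : vnorm (a *: x) = cabs a * vnorm x.
Proof. by apply: complexI; rewrite rmorphM/= !vnormE cabsE normrZ. Qed.

Lemma vnorm_eq0 x : vnorm x = 0 -> x = 0.
Proof. by move=> x0; apply/normr0_eq0; rewrite -vnormE x0. Qed.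

Lemma continuous_on_bounded (Z : set X) (S : X -> X) :
  Z 0 -> (forall (a : C) x y, Z x -> Z y -> Z (a *: x + y)) ->
  (forall (a : C) x y, Z x -> Z y -> S (a *: x + y) = a *: S x + S y) ->
  {within Z, continuous S} ->
  exists2 M : R, 0 < M & forall y, Z y -> vnorm (S y) <= M * vnorm y.
Proof.
move=> Z0 Zlin Slin /subspace_continuousP /(_ 0 Z0) S0.
have SE0 : S 0 = 0.
  by have := Slin (-1) 0 0 Z0 Z0; rewrite scaler0 addr0 scaleN1r addNr.
have ZZ a y : Z y -> Z (a *: y) by move=> Zy; rewrite -[_ *: _]addr0; exact: Zlin.
have SZ a y : Z y -> S (a *: y) = a *: S y.
  by move=> Zy; have := Slin a y 0 Zy Z0; rewrite SE0 !addr0.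
have /cvgrPdist_lt/(_ 1 ltr01)/nbhs_ballP[e /= e0 eP] := S0.
have eE : e = ((complex.Re e)%:C)%C by rewrite RRe_real// gtr0_real.
have e0' : 0 < complex.Re e by rewrite -ltcR -eE.
set d := complex.Re e in eE e0'.
have small y : Z y -> vnorm y < d -> vnorm (S y) < 1.
  move=> Zy yd; have : `|S 0 - S y| < 1.
    by apply: (eP y) => //; rewrite -ball_normE /ball_/= sub0r normrN eE -vnormE ltcR.
  by rewrite SE0 sub0r normrN -vnormE -(rmorph1 (real_complex R)) ltcR.
exists (2 / d) => [|y Zy]; first by rewrite divr_gt0.
have [y0|y0] := eqVneq (vnorm y) 0.
  by rewrite (vnorm_eq0 y0) SE0 -(vnorm_eq0 y0) y0 mulr0.
have yp : 0 < vnorm y by rewrite lt_neqAle eq_sym y0 vnorm_ge0.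
pose a := d / (2 * vnorm y).
have a0 : 0 < a by rewrite divr_gt0// mulr_gt0.
have := small ((a%:C)%C *: y) (ZZ _ _ Zy).
rewrite SZ// !vnormZ cabsR gtr0_norm//.
have -> : a * vnorm y = d / 2 by rewrite /a; field; rewrite gt_eqF.
move=> /(_ ltac:(lra)) h.
rewrite -(ler_pM2l a0); apply: le_trans (ltW h) _.
by rewrite le_eqVlt; apply/orP; left; apply/eqP; rewrite /a; field; rewrite !gt_eqF.
Qed.

End VectorNorm.

Section Calculus.
Variables (R : realType) (s : set R[i]) (X : completeNormedModType R[i]).
Variables (T : {linear X -> X}) (psi : (s -> R[i]) -> {linear X -> X}) (K : R).
Hypotheses (s_neq0 : s !=set0) (s_compact : compact s).
Hypothesis psi_cont : forall f, ACfun f -> continuous (psi f).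
Hypothesis psi_lin : forall (a : R[i]) f g, ACfun f -> ACfun g ->
  forall x, psi (a *: f + g) x = a *: psi f x + psi g x.
Hypothesis psi_mul : forall f g, ACfun f -> ACfun g ->
  forall x, psi (f * g) x = psi f (psi g x).
Hypothesis psi1 : forall x, psi 1 x = x.
Hypothesis psi_bounded : forall f, ACfun f -> forall x : X,
  `|psi f x| <= ((K * fine (BVnorm f))%:C)%C * `|x|.
Hypothesis psi_lambda : forall x, psi (@lambda R s) x = T x.
Local Notation C := R[i].
Implicit Types (f g : s -> C) (Z : set X) (F U : set C).

Local Notation AC_cst := (AC_cst s_neq0 s_compact).
Local Notation ACD := (ACD s_neq0 s_compact).
Local Notation ACB := (ACB s_neq0 s_compact).
Local Notation ACM := (ACM s_neq0 s_compact).
Local Notation ACZ := (ACZ s_neq0 s_compact).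

Lemma psiM f g x : ACfun f -> ACfun g -> psi (fun z => f z * g z) x = psi f (psi g x).
Proof. by move=> fA gA; rewrite -psi_mul. Qed.

Lemma psiD f g x : ACfun f -> ACfun g -> psi (fun z => f z + g z) x = psi f x + psi g x.
Proof.
move=> fA gA; rewrite -[psi f x]scale1r -psi_lin//; congr (psi _ x).
by apply/funext => z; rewrite -[RHS]/(1 * f z + g z) mul1r.
Qed.

Lemma psi0 x : psi (fun=> 0) x = 0.
Proof.
have zA := AC_cst 0.
rewrite -[RHS](addNr (psi (fun=> 0) x)) -scaleN1r -psi_lin//; congr (psi _ x).
by apply/funext => z; rewrite -[RHS]/(-1 * 0 + 0 : C) mulr0 addr0.
Qed.

Lemma psiB f g x : ACfun f -> ACfun g -> psi (fun z => f z - g z) x = psi f x - psi g x.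
Proof.
move=> fA gA; rewrite addrC -scaleN1r -psi_lin//; congr (psi _ x).
by apply/funext => z; rewrite -[RHS]/(-1 * g z + f z) mulN1r addrC.
Qed.

Lemma psi_cst a x : psi (fun=> a) x = a *: x.
Proof.
rewrite -[a *: x]addr0 -(psi0 x) -{2}(psi1 x) -psi_lin; [|exact: AC1|exact: AC_cst].
congr (psi _ x).
by apply/funext => z; rewrite -[RHS]/(a * 1 + 0) mulr1 addr0.
Qed.

Lemma psi_comm f g x : ACfun f -> ACfun g -> psi f (psi g x) = psi g (psi f x).
Proof.
by move=> fA gA; rewrite -!psiM//; congr (psi _ x); apply/funext => z; rewrite mulrC.
Qed.

Lemma AC_shift mu : ACfun (fun z : s => \val z - mu).
Proof. exact: (ACB (AC_lambda (s := s)) (AC_cst mu)). Qed.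

Lemma psi_shift mu x : psi (fun z => \val z - mu) x = T x - mu *: x.
Proof. by rewrite -psi_lambda -psi_cst -psiB//; [exact: AC_lambda|exact: AC_cst]. Qed.

Lemma vnorm_psi f B V x : ACfun f -> bv_bound f B V ->
  vnorm (psi f x) <= `|K| * (B + V) * vnorm x.
Proof.
move=> fA fV; have := psi_bounded fA x; rewrite -!vnormE -rmorphM lecR => /le_trans; apply.
rewrite ler_wpM2r ?vnorm_ge0//; apply: le_trans (ler_norm _) _.
rewrite normrM ler_wpM2l// ger0_norm ?fine_BVnorm_ge0//.
exact: fine_BVnorm_le.
Qed.

(** If T - mu has a bounded right inverse S on Z, functions carried by a small
    square around mu annihilate Z. For such f, psi f x = psi f ((T - mu) S x)
    = psi h (psi f (S x)) where h is the local identity, whose norm is of order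
    d; so psi f x is at most (const * d * |S|)^n times a constant for every n. *)
Lemma psi_local_null Z (S : X -> X) mu :
  Z 0 -> (forall (a : C) x y, Z x -> Z y -> Z (a *: x + y)) ->
  (forall y, Z y -> Z (S y)) ->
  (forall (a : C) x y, Z x -> Z y -> S (a *: x + y) = a *: S x + S y) ->
  {within Z, continuous S} ->
  (forall y, Z y -> T (S y) - mu *: S y = y) ->
  exists2 d, 0 < d & forall f, ACfun f ->
    (forall z : s, ~ square mu d (\val z) -> f z = 0) ->
    forall x, Z x -> psi f x = 0.
Proof.
move=> Z0 Zlin ZS Slin Scont Sres.
have [M M0 SM] := continuous_on_bounded Z0 Zlin Slin Scont.
(* 6 d is the norm of the local identity, and 6 d |K| M should be at most 1/2. *)
pose d := (12 * (`|K| + 1) * M)^-1.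
have K0 : 0 < `|K| + 1 by have := normr_ge0 K; lra.
have d0 : 0 < d by rewrite invr_gt0 !mulr_gt0.
exists d => // f fA fd x Zx.
have [B [V fV]] := AC_bv_bound s_neq0 s_compact fA.
have step y : Z y -> vnorm (psi f y) <= `|K| * (6 * d) * vnorm (psi f (S y)).
  move=> Zy; rewrite -{1}(Sres y Zy) -psi_shift psi_comm//; last exact: AC_shift.
  have hA := AC_local_id s_neq0 s_compact mu (ltW d0).
  have -> : psi (fun z => \val z - mu) (psi f (S y)) =
            psi (fun z => local_id mu d (\val z)) (psi f (S y)).
    rewrite -!psiM//; last exact: AC_shift.
    congr (psi _ (S y)); apply/funext => z.
    have [zd|zd] := pselect (square mu d (\val z)); first by rewrite local_idE.
    by rewrite fd// !mulr0.
  have := vnorm_psi (psi f (S y)) hA (bv_bound_local_id s_neq0 mu (ltW d0)).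
  by have -> : 2 * d + 4 * d = 6 * d by ring.
have decay n y : Z y -> vnorm (psi f y) <= `|K| * (B + V) * 2^-1 ^+ n * vnorm y.
  elim: n y => [|n IH] y Zy; first by rewrite expr0 mulr1; exact: vnorm_psi.
  apply: le_trans (step y Zy) _.
  have c0 : 0 <= `|K| * (6 * d) by rewrite !mulr_ge0// ltW.
  apply: le_trans (ler_wpM2l c0 (IH _ (ZS _ Zy))) _.
  have KBV : 0 <= `|K| * (B + V).
    have [fB V0 _] := fV; rewrite mulr_ge0// addr_ge0//.
    by have [z sz] := s_neq0; apply: le_trans (fB (SigSub (mem_set sz))); exact: cabs_ge0.
  have p0 : 0 <= `|K| * (B + V) * 2^-1 ^+ n by rewrite mulr_ge0// exprn_ge0// invr_ge0.
  apply: le_trans (ler_wpM2l c0 (ler_wpM2l p0 (SM _ Zy))) _.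
  rewrite exprS.
  have cM : `|K| * (6 * d) * M <= 2^-1.
    rewrite /d.
    have -> : `|K| * (6 * (12 * (`|K| + 1) * M)^-1) * M = 2^-1 * (`|K| / (`|K| + 1)).
      by field; rewrite !gt_eqF.
    rewrite ler_piMr// ler_pdivrMr// mul1r; lra.
  set p := `|K| * (B + V) * 2^-1 ^+ n in p0 *.
  have := ler_wpM2r (mulr_ge0 p0 (vnorm_ge0 y)) cM.
  have -> : `|K| * (6 * d) * (p * (M * vnorm y)) =
            `|K| * (6 * d) * M * (p * vnorm y) by ring.
  move=> /le_trans; apply.
  rewrite /p; rewrite le_eqVlt; apply/orP; left; apply/eqP; ring.
apply: vnorm_eq0; apply/eqP; rewrite eq_le vnorm_ge0 andbT leNgt; apply/negP => xp.
have [|n nP] := @exp_small R 2^-1 (`|K| * (B + V) * vnorm x) _ _ xp.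
  by apply/andP; split; lra.
have := decay n x Zx; rewrite mulrAC => /le_lt_trans/(_ nP); by rewrite ltxx.
Qed.

Definition vanishes_near F f : Prop :=
  exists U, [/\ open U, F `<=` U & forall z : s, U (\val z) -> f z = 0].

(** The vectors whose support, in the sense of the functional calculus, lies
    in F. *)
Definition spectral_space F : set X :=
  [set x | forall f, ACfun f -> vanishes_near F f -> psi f x = 0].

Lemma spectral_space_psi F g x : ACfun g -> spectral_space F x ->
  spectral_space F (psi g x).
Proof. by move=> gA xF f fA fF; rewrite psi_comm// xF// linear0. Qed.

Lemma spectral_space_invariant F : closed_invariant T (spectral_space F).
Proof.
split; last first.
  by move=> x xF; rewrite -psi_lambda; apply: spectral_space_psi => //; exact: AC_lambda.
split.
- move=> x xF f fA fF.
  have : closed (psi f @^-1` [set 0]).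
    apply: closed_comp => [y _|]; first exact: psi_cont.
    exact: accessible_closed_set1 (hausdorff_accessible (@norm_hausdorff _ X)) 0.
  apply; apply: closureS xF => y yF; exact: yF.
- by move=> f _ _; rewrite linear0.
- by move=> a x y xF yF f fA fF; rewrite linearP xF// yF// scaler0 addr0.
Qed.

Lemma spectral_space_psi_in F g x : ACfun g ->
  (forall z : s, ~ F (\val z) -> g z = 0) -> spectral_space F (psi g x).
Proof.
move=> gA gF f fA [U [oU FU fU]]; rewrite -psiM//.
rewrite [X in psi X](_ : _ = fun=> 0) ?psi0//; apply/funext => z.
have [zF|zF] := pselect (F (\val z)); first by rewrite fU ?mul0r//; exact: FU.
by rewrite gF ?mulr0.
Qed.

(** Off F the inverse of T - mu on the spectral space is psi q, where
    q = conj(z - mu) / (|z - mu|^2 + chi) and chi is a plateau around mu carried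
    by the complement of F: then (z - mu) q is 1 minus a function that vanishes
    near F, so its image under psi acts as the identity on the spectral space. *)
Lemma spectrum_spectral_space F : closed F ->
  spectrum_on (spectral_space F) T `<=` F.
Proof.
move=> cF mu; apply: contraPP => muF.
have [e e0 eF] := open_square_sub (closed_openC cF) muF.
pose d := e / 2; have d0 : 0 < d by rewrite divr_gt0.
pose chi z : R := square_plateau mu d z.
pose r (z : C) : R := (complex.Re z - complex.Re mu) ^+ 2 + (complex.Im z - complex.Im mu) ^+ 2
   + chi z.
pose c := Num.min 1 ((d / 2) ^+ 2).
have c0 : 0 < c by rewrite lt_min ltr01 exprn_gt0// divr_gt0.
have chi0 z : 0 <= chi z by exact: square_plateau_ge0.
have rc z : c <= r z.
  have [zd|zd] := pselect (square mu (d / 2) z).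
    have : chi z = 1 by exact: square_plateau1.
    rewrite /r => ->; apply: (@le_trans _ _ 1); first by rewrite ge_min lexx.
    by rewrite lerDr addr_ge0 ?sqr_ge0.
  apply: (@le_trans _ _ ((d / 2) ^+ 2)); first by rewrite ge_min lexx orbT.
  have sq x : d / 2 <= `|x| -> (d / 2) ^+ 2 <= x ^+ 2.
    by move=> h; rewrite -[x ^+ 2]real_normK ?num_real// ler_sqr ?nnegrE// ltW// divr_gt0.
  have [h1|/sq h1] := ltP `|complex.Re z - complex.Re mu| (d / 2); last first.
    by rewrite /r -addrA ler_wpDr// addr_ge0 ?sqr_ge0.
  have [h2|/sq h2] := ltP `|complex.Im z - complex.Im mu| (d / 2); last first.
    by rewrite /r ler_wpDr// ler_wpDl ?sqr_ge0.
  by case: zd.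
have chiA : ACfun (fun z : s => ((chi (\val z))%:C)%C) by exact: AC_square_plateau.
have barA : ACfun (fun z : s => ((\val z)^* - mu^*)%C).
  exact: (ACB (AC_lambda_bar (s := s)) (AC_cst (mu^*)%C)).
have modE (z : C) : (z - mu) * (z^* - mu^*)%C = ((r z - chi z)%:C)%C.
  by rewrite /r addrK mul_conj_sub.
have rA : ACfun (fun z : s => ((r (\val z))%:C)%C).
  have := ACD (ACM (AC_shift mu) barA) chiA; congr (@ACfun R s _); apply/funext => z.
  by rewrite modE -rmorphD subrK.
have invA := AC_inv s_neq0 s_compact c0 (fun z : s => rc (\val z)) rA.
pose q (z : s) : C := ((\val z)^* - mu^*)%C * (((r (\val z))^-1)%:C)%C.
have qA : ACfun q by exact: ACM.
pose t (z : s) : C := ((chi (\val z))%:C)%C * (((r (\val z))^-1)%:C)%C.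
have tA : ACfun t by exact: ACM.
have qE (z : s) : (\val z - mu) * q z = 1 - t z.
  rewrite /q /t mulrA modE -!rmorphM -(rmorph1 (real_complex R)) -rmorphB; congr (_%:C)%C.
  by field; rewrite gt_eqF// (lt_le_trans c0).
have tF : vanishes_near F t.
  exists (~` closed_square mu d); split.
  - by apply: closed_openC; exact: closed_square_closed.
  - move=> z zF zd; apply: (eF z) => //; apply: closed_squareS zd.
    by rewrite /d; lra.
  - move=> z zd; rewrite /t /chi square_plateau0 ?mul0r// => zd'.
    by apply: zd; case: zd' => h1 h2; split; exact: ltW.
have res y : spectral_space F y -> psi (fun z => (\val z - mu) * q z) y = y.
  move=> yF; rewrite [X in psi X](_ : _ = fun z => 1 - t z); last exact/funext.
  by rewrite psiB//; [rewrite psi_cst scale1r yF// subr0|exact: AC_cst].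
move=> /(_ _); apply; exists (psi q); split.
- by move=> y; exact: spectral_space_psi.
- by move=> a x y _ _; rewrite linearP.
- by apply: continuous_subspaceT; exact: psi_cont.
- move=> y yF; rewrite -psi_shift psi_comm//; last exact: AC_shift.
  by rewrite -psiM ?res//; exact: AC_shift.
- by move=> y yF; rewrite -psi_shift -psiM ?res//; exact: AC_shift.
Qed.

(** Let f vanish on a neighbourhood U of F. That psi (f g) x = 0 is local in g: around
    a point of U the product f g is 0, and around a point outside F, where T has
    a resolvent on Z, functions carried by a small square annihilate Z. So it
    holds for g = 1. *)
Lemma spectral_space_maximal F Z : closed_invariant T Z ->
  spectrum_on Z T `<=` F -> Z `<=` spectral_space F.
Proof.
move=> [[cZ Z0 Zlin] ZT] ZF x Zx f fA [U [oU FU fU]].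
have fE : psi (fun z => f z * 1) x = 0; last first.
  by rewrite -[RHS]fE; congr (psi _ x); apply/funext => z; rewrite mulr1.
apply: (@AC_localisation R s s_neq0 s_compact
  (fun g => psi (fun z => f z * g z) x = 0) _ _ _ (fun=> 1)).
- by rewrite -[RHS](psi0 x); congr (psi _ x); apply/funext => z; rewrite mulr0.
- move=> g h gA hA gE hE.
  rewrite [X in psi X](_ : _ = fun z => f z * g z + f z * h z).
    by rewrite psiD ?gE ?hE ?addr0//; exact: ACM.
  by apply/funext => z; rewrite mulrDr.
- move=> w sw; have [wU|wU] := pselect (U w).
    have [d d0 dU] := open_square_sub oU wU.
    exists d => // g gA gd.
    rewrite -[RHS](psi0 x); congr (psi _ x); apply/funext => z.
    have [zd|zd] := pselect (square w d (\val z)); last by rewrite gd ?mulr0.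
    by rewrite fU ?mul0r//; exact: dU.
  have [S [ZS Slin Scont _ Sres]] : exists S : X -> X,
    [/\ forall y, Z y -> Z (S y),
        forall (a : C) x y, Z x -> Z y -> S (a *: x + y) = a *: S x + S y,
        {within Z, continuous S},
        forall y, Z y -> S (T y - w *: y) = y
      & forall y, Z y -> T (S y) - w *: S y = y].
    by apply: contrapT => h; apply: wU; apply: FU; apply: ZF.
  have [d d0 dP] := psi_local_null Z0 Zlin ZS Slin Scont Sres.
  by exists d => // g gA gd; rewrite psiM// (dP g gA gd x Zx) linear0.
- exact: AC_cst.
Qed.

Lemma spectral_space_spectral_maximal F : closed F ->
  spectral_maximal T (spectral_space F).
Proof.
move=> cF; split; first exact: spectral_space_invariant.
move=> Z ZT ZF; apply: spectral_space_maximal => //.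
exact: subset_trans ZF (spectrum_spectral_space cF).
Qed.

(** A function that vanishes near s is 0, so the spectral space of s is X. *)
Lemma spectrum_sub : spectrum T `<=` s.
Proof.
have cs : closed s by apply: compact_closed => //; exact: norm_hausdorff.
have := spectrum_spectral_space cs.
rewrite (_ : spectral_space s = [set: X])//.
apply/seteqP; split=> // x _ f fA [U [oU sU fU]].
rewrite (_ : f = fun=> 0) ?psi0//; apply/funext => z; apply: fU; apply: sU.
exact: set_valP.
Qed.

(** The functions g with psi g = sum of psi (f k), each f k carried by a closed
    subset F k of G k, form a class to which the localisation principle applies:
    around a point of the spectrum one of the G k is available, and around any
    other point small squares carry only functions with psi g = 0. For g = 1 this
    decomposes every vector along the spectral spaces of the F k. *)
Lemma calculus_decomposable : decomposable T.
Proof.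
move=> n G oG covG.
pose P g := exists (F : 'I_n -> set C) (f : 'I_n -> (s -> C)),
  [/\ forall k, closed (F k) /\ F k `<=` G k,
      forall k, ACfun (f k) /\ (forall z : s, ~ F k (\val z) -> f k z = 0)
    & forall x, psi g x = \sum_(k < n) psi (f k) x].
have P0 g : (forall x, psi g x = 0) -> P g.
  move=> g0; exists (fun=> set0), (fun _ _ => 0); split.
  - by move=> k; split; [exact: closed0|].
  - by move=> k; split; [exact: AC_cst|].
  - by move=> x; rewrite g0 big1// => k _; exact: psi0.
have : P (fun=> 1).
  apply: (@AC_localisation R s s_neq0 s_compact P _ _ _ (fun=> 1)).
  - by apply: P0; exact: psi0.
  - move=> g h gA hA [F [f [FG fA fE]]] [F' [f' [FG' fA' fE']]].
    exists (fun k => F k `|` F' k), (fun k z => f k z + f' k z); split.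
    + move=> k; have [c1 s1] := FG k; have [c2 s2] := FG' k.
      by split; [exact: closedU|rewrite subUset].
    + move=> k; have [a1 v1] := fA k; have [a2 v2] := fA' k.
      split; first exact: ACD.
      by move=> z /not_orP[h1 h2]; rewrite v1// v2// addr0.
    + move=> x; rewrite psiD// fE fE' -big_split/=; apply: eq_bigr => k _.
      by rewrite psiD//; [have [] := fA k|have [] := fA' k].
  - move=> w sw; have [wT|wT] := pselect (spectrum T w).
      have [k _ wG] := covG w wT.
      have [e e0 eG] := open_square_sub (oG k) wG.
      have d0 : 0 < e / 2 by rewrite divr_gt0.
      exists (e / 2) => // g gA gd.
      exists (fun j => if j == k then closed_square w (e / 2) else set0),
        (fun j => if j == k then g else fun=> 0); split.
      + move=> j; case: eqP => [->|_]; last by split; [exact: closed0|].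
        split; first exact: closed_square_closed.
        by apply: subset_trans eG; apply: closed_squareS; lra.
      + move=> j; case: eqP => _; last by split; [exact: AC_cst|].
        split=> // z zF; apply: gd => -[h1 h2].
        by apply: zF; split; exact: ltW.
      + move=> x; rewrite (bigD1 k)//= eqxx big1 ?addr0// => j /negPf ->.
        exact: psi0.
    have [S [ZS Slin Scont _ Sres]] : exists S : X -> X,
      [/\ forall y, [set: X] y -> [set: X] (S y),
          forall (a : C) x y, [set: X] x -> [set: X] y ->
            S (a *: x + y) = a *: S x + S y,
          {within [set: X], continuous S},
          forall y, [set: X] y -> S (T y - w *: y) = y
        & forall y, [set: X] y -> T (S y) - w *: S y = y].
      exact: contrapT.
    have [d d0 dP] := psi_local_null (Z := [set: X]) I (fun _ _ _ _ _ => I) ZS Slin Scont Sres.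
    by exists d => // g gA gd; apply: P0 => x; exact: dP.
  - exact: AC_cst.
move=> [F [f [FG fA fE]]].
exists (fun k => spectral_space (F k)); split.
- by move=> k; apply: spectral_space_spectral_maximal; have [] := FG k.
- move=> k; have [cF FkG] := FG k.
  exact: subset_trans (spectrum_spectral_space cF) FkG.
- move=> x; exists (fun k => psi (f k) x).
    by move=> k; have [a v] := fA k; exact: spectral_space_psi_in.
  by rewrite -fE psi_cst scale1r.
Qed.

End Calculus.

Theorem proposition5p3 (R : realType) (s : set R[i]) (X : completeNormedModType R[i])
    (T : {linear X -> X}) (s_neq0 : s !=set0) (s_compact : compact s)
    (T_bounded : continuous T) (T_AC : AC_operator s T) :
  spectrum T `<=` s /\ decomposable T.
Proof.
have [psi [[psi_cont psi_lin psi_mul] psi1 [K psi_bounded] psi_lambda]] := T_AC.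
split.
  exact: (spectrum_sub s_neq0 s_compact psi_cont psi_lin psi_mul psi1 psi_lambda).
exact: (calculus_decomposable s_neq0 s_compact psi_cont psi_lin psi_mul psi1 psi_bounded
  psi_lambda).
Qed.
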